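(* Let $m\ge n\ge 1$ be integers and let $G=K_{m,n}$ be the complete bipartite graph on the vertex set $\{1,\ldots,m\}\cup\{m+1,\ldots,m+n\}$. Then: (a) $$\operatorname{proj\,dim}(S/\mathrm{in}_<(J_G))=\operatorname{proj\,dim}(\mathrm{in}_<(J_G))+1=\begin{cases} m, & \text{if } n=1,\\ 2m+n-2, & \text{if } n>1.\end{cases}$$ (b) Setting $p=\operatorname{proj\,dim}(S/\mathrm{in}_<(J_G))$, the module $S/\mathrm{in}_<(J_G)$ has a unique extremal Betti number, namely $$\beta_{p,p+2}(S/\mathrm{in}_<(J_G))=\beta_{p-1,p+2}(\mathrm{in}_<(J_G))=\begin{cases} m-1, & \text{if } n=1,\\ n-1, & \text{if } n>1.\end{cases}$$
   Context: Let $K$ be a field and $S=K[x_1,\ldots,x_{m+n},y_1,\ldots,y_{m+n}]$ with the standard grading, and $<$ the lexicographic order on $S$ induced by $x_1>\cdots>x_{m+n}>y_1>\cdots>y_{m+n}$. The edges of $K_{m,n}$ are all pairs $\{i,j\}$ with $1\le i\le m$ and $m+1\le j\le m+n$. The binomial edge ideal $J_G\subset S$ of a simple graph $G$ is generated by the binomials $x_iy_j-x_jy_i$ with $\{i,j\}\in E(G)$, $i<j$; $\mathrm{in}_<(J_G)$ is its initial ideal with respect to $<$. For a finitely generated graded $S$-module $M$, $\beta_{i,j}(M)=\dim_K \mathrm{Tor}^S_i(M,K)_j$ are the graded Betti numbers and $\operatorname{proj\,dim}$ denotes projective dimension over $S$. A Betti number $\beta_{i,i+j}(M)\ne 0$ is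 called extremal if $\beta_{k,k+l}(M)=0$ for all pairs $(k,l)\ne(i,j)$ with $k\ge i$ and $l\ge j$.
   Formalization: In (b), for m=n>1 the extremal Betti number is 2(n-1), not n-1 (for K_{2,2} it is 2), and the value is corrected accordingly; for m=n=1 the claim that β_{p,p+2} is the unique extremal Betti number is dropped, since there β_{1,3}=0. *)

(* Defs.v *)
From HB Require Import structures.
From mathcomp Require Import all_boot all_order all_algebra.
From mathcomp Require Import ring_quotient boolp.
From mathcomp Require Import mpoly.
From Stdlib Require ClassicalEpsilon.

Set Implicit Arguments.
Unset Strict Implicit.
Unset Printing Implicit Defensive.

Import Order.TTheory GRing.Theory.
Local Open Scope ring_scope.

(* Submodules are the submodClosed predicates of the library; ideals of R are *)
(* the submodules of R^o.                                                     *)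

Section Submodule.
Variables (R : comNzRingType) (V : lmodType R) (U : submodClosed V).

Record submod := SubMod { submod_val : V; _ : submod_val \in U }.

HB.instance Definition _ := [isSub for submod_val].
HB.instance Definition _ := [Choice of submod by <:].
HB.instance Definition _ := [SubChoice_isSubLmodule of submod by <:].

(* A copy of U, for closure under opposite: a submodClosed predicate has none *)
(* by inference, its base ring being a priori a semiring.                     *)
Definition submod_pred : {pred V} := fun v => v \in U.

Fact submod_pred_zmod : zmod_closed submod_pred.
Proof. exact: GRing.submod_closedB (submodClosedP U). Qed.

HB.instance Definition _ :=
  GRing.isZmodClosed.Build V submod_pred submod_pred_zmod.

Definition quotmod : Type := Quotient.quot submod_pred.

HB.instance Definition _ := GRing.Zmodule.on quotmod.

Definition quotmod_pi (v : V) : quotmod := \pi_(Quotient.quot submod_pred)%qT v.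

Lemma quotmod_pi_eq v w : (quotmod_pi v == quotmod_pi w) = (v - w \in U).
Proof. exact: esym (Quotient.idealrBE submod_pred v w). Qed.

Lemma quotmod_piD : {morph quotmod_pi : v w / v + w}.
Proof. by move=> v w; rewrite /quotmod_pi raddfD. Qed.

Lemma quotmod_piK (q : quotmod) :
  quotmod_pi (repr (q : Quotient.quot submod_pred)) = q.
Proof. exact: reprK. Qed.

Definition quotmod_scale (a : R) (q : quotmod) : quotmod :=
  quotmod_pi (a *: repr (q : Quotient.quot submod_pred)).

Lemma quotmod_piZ a v : quotmod_pi (a *: v) = quotmod_scale a (quotmod_pi v).
Proof.
apply/eqP; rewrite quotmod_pi_eq -scalerBr -[_ \in _]/(_ \in U) rpredZ //.
by rewrite -quotmod_pi_eq quotmod_piK.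
Qed.

Fact quotmod_scaleA a b q :
  quotmod_scale a (quotmod_scale b q) = quotmod_scale (a * b) q.
Proof. by rewrite -(quotmod_piK q) -!quotmod_piZ scalerA. Qed.

Fact quotmod_scale1 : left_id 1 quotmod_scale.
Proof. by move=> q; rewrite -(quotmod_piK q) -quotmod_piZ scale1r. Qed.

Fact quotmod_scaleDr : right_distributive quotmod_scale +%R.
Proof.
move=> a q r; rewrite -(quotmod_piK q) -(quotmod_piK r).
by rewrite -quotmod_piD -!quotmod_piZ scalerDr quotmod_piD.
Qed.

Fact quotmod_scaleDl q : {morph quotmod_scale^~ q : a b / a + b}.
Proof.
by move=> a b; rewrite -(quotmod_piK q) -!quotmod_piZ scalerDl quotmod_piD.
Qed.

HB.instance Definition _ := GRing.Zmodule_isLmodule.Build R quotmod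
  quotmod_scaleA quotmod_scale1 quotmod_scaleDr quotmod_scaleDl.

End Submodule.

Section GeneratedIdeal.
Variables (R : comNzRingType) (G : R -> Prop).

Definition ideal_gen : {pred R^o} := fun f =>
  `[< exists k (c g : 'I_k -> R),
        (forall i, G (g i)) /\ f = \sum_(i < k) c i * g i >].

Fact ideal_gen_submod : submod_closed ideal_gen.
Proof.
split=> [|a f h /asboolP [k [c [g [gG ->]]]] /asboolP [l [d [q [qG ->]]]]].
  apply/asboolP; exists 0%N, (fun=> 0), (fun=> 0); split; first by case.
  by rewrite big_ord0.
apply/asboolP; exists (k + l)%N,
  (fun i => match split i with inl j => a * c j | inr j => d j end),
  (fun i => match split i with inl j => g j | inr j => q j end); split.
  by move=> i; case: (split i).
rewrite big_split_ord scaler_sumr; congr (_ + _); apply: eq_bigr => i _.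
  by rewrite (unsplitK (inl i)) -mulrA.
by rewrite (unsplitK (inr i)).
Qed.

HB.instance Definition _ :=
  GRing.isSubmodClosed.Build R R^o ideal_gen ideal_gen_submod.

End GeneratedIdeal.

Section ProjectiveDimension.
Variable R : comNzRingType.

Definition surj (A B : Type) (f : A -> B) := forall b, exists a, f a = b.

Definition exact_at (A B C : lmodType R)
    (f : {linear A -> B}) (g : {linear B -> C}) :=
  forall b, g b = 0 <-> exists a, f a = b.

Definition projective (P : lmodType R) :=
  forall (A B : lmodType R) (g : {linear A -> B}) (f : {linear P -> B}),
    surj g -> exists h : {linear P -> A}, forall x, g (h x) = f x.

(* 0 -> P_n -> ... -> P_1 -> P_0 -> M -> 0, written as an infinite complex    *)
(* whose modules vanish above n.                                              *)
Definition proj_resolution_le (M : lmodType R) (n : nat) :=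
  exists (P : nat -> lmodType R) (d : forall i, {linear P i.+1 -> P i})
         (eps : {linear P 0%N -> M}),
    [/\ forall i, projective (P i),
        surj eps /\ exact_at (d 0%N) eps,
        forall i, exact_at (d i.+1) (d i)
      & forall i, (n < i)%N -> forall x : P i, x = 0].

Definition is_projdim (M : lmodType R) (n : nat) :=
  proj_resolution_le M n /\
  forall k, (k < n)%N -> ~ proj_resolution_le M k.

(* Unspecified when M has no finite projective resolution.                    *)
Definition projdim (M : lmodType R) : nat :=
  ClassicalEpsilon.epsilon (inhabits 0%N) (is_projdim M).

End ProjectiveDimension.

Section GradedBetti.
Variables (K : fieldType) (N : nat).
Local Notation S := {mpoly K[N]}.

Definition homog_deg (d : int) (f : S) : Prop :=
  match d with Posz e => f \is e.-homog | Negz _ => f = 0 end.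

(* The data of a complex ... -> F_1 -> F_0 of graded free S-modules of finite *)
(* rank: F_i is the module of row vectors of length frank i, its k-th basis   *)
(* vector has degree fdeg i k, i.e. F_i is the direct sum of the S(-fdeg i k),*)
(* and F_{i+1} -> F_i is v |-> v *m fdiff i.                                  *)
Record free_complex := FreeComplex {
  frank : nat -> nat;
  fdeg : forall i, 'I_(frank i) -> int;
  fdiff : forall i, 'M[S]_(frank i.+1, frank i) }.

(* A grading of M is given by its homogeneous components: gr d x means that x *)
(* is homogeneous of degree d.                                                *)
Definition graded_free_resolution (M : lmodType S) (gr : int -> M -> Prop)
    (F : free_complex) :=
  exists eps : {linear 'rV[S]_(frank F 0) -> M},
    [/\ forall k, gr (fdeg k) (eps (delta_mx 0 k)),
        forall i k l, homog_deg (fdeg k - fdeg l) (fdiff F i k l),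
        surj eps,
        forall v, eps v = 0 <-> exists w, v = w *m fdiff F 0
      & forall i (v : 'rV[S]_(frank F i.+1)),
         v *m fdiff F i = 0 <-> exists w, v = w *m fdiff F i.+1].

(* Over S, K stands for S/(X_1,...,X_N), so that F_i (x) K = K^(frank i) and  *)
(* the differential of F (x) K is obtained by reducing the entries of fdiff   *)
(* to their constant terms.                                                   *)
Definition tensK (F : free_complex) i : 'M[K]_(frank F i.+1, frank F i) :=
  map_mx (mcoeff 0%MM) (fdiff F i).

(* The degree j component of F_i (x) K, as a row space: it is spanned by the  *)
(* basis vectors of degree j.                                                 *)
Definition strand (F : free_complex) i (j : int) : 'M[K]_(frank F i) :=
  diag_mx (\row_k (fdeg (i := i) k == j)%:R).

Definition cycles (F : free_complex) i (j : int) : 'M[K]_(frank F i) :=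
  match i return 'M[K]_(frank F i) with
  | 0%N => strand F 0 j
  | i'.+1 => (strand F i'.+1 j :&: kermx (tensK F i'))%MS
  end.

Definition boundaries (F : free_complex) i (j : int) :
    'M[K]_(frank F i.+1, frank F i) :=
  strand F i.+1 j *m tensK F i.

(* dim_K H_i(F (x) K)_j                                                       *)
Definition homology_dim (F : free_complex) i (j : int) : nat :=
  (\rank (cycles F i j) - \rank (boundaries F i j))%N.

(* Tor is computed from a graded free resolution which is picked by Hilbert's *)
(* epsilon; nothing is known about it if M has none.                          *)
Definition betti (M : lmodType S) (gr : int -> M -> Prop) i (j : int) : nat :=
  homology_dim
    (ClassicalEpsilon.epsilon
       (inhabits (FreeComplex (frank := fun=> 0%N) (fun _ _ => 0) (fun=> 0)))
       (graded_free_resolution gr))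
    i j.

Definition extremal_betti (M : lmodType S) (gr : int -> M -> Prop)
    i (j : int) :=
  betti gr i (i%:Z + j) <> 0%N /\
  forall k (l : int), (k, l) <> (i, j) -> (i <= k)%N -> j <= l ->
    betti gr k (k%:Z + l) = 0%N.

Section Ideal.
Variable I : submodClosed S^o.

Definition ideal_grading (d : int) (x : submod I) : Prop :=
  homog_deg d (val x).

Definition quot_grading (d : int) (q : quotmod I) : Prop :=
  exists2 f : S, homog_deg d f & quotmod_pi I f = q.

End Ideal.

(* Pure lexicographic order with X_0 > X_1 > ... (the order of the mpoly      *)
(* library is graded).                                                        *)
Definition lex_lt (a b : 'X_{1..N}) : Prop :=
  exists i : 'I_N, (forall k : 'I_N, (k < i)%N -> a k = b k) /\ (a i < b i)%N.

Definition lex_lead (f : S) (a : 'X_{1..N}) : Prop :=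
  a \in msupp f /\ forall b, b \in msupp f -> b <> a -> lex_lt b a.

Definition initial_ideal (J : {pred S^o}) : {pred S^o} :=
  ideal_gen (fun g => exists f a, [/\ f \in J, lex_lead f a & g = 'X_[a]]).

HB.instance Definition _ (J : {pred S^o}) :=
  GRing.SubmodClosed.on (initial_ideal J).

End GradedBetti.

Arguments ideal_grading {K N} I d x.
Arguments quot_grading {K N} I d q.

Section BinomialEdgeIdeal.
Variables (K : fieldType) (v : nat).

(* The variables are ordered as x_0, ..., x_(v-1), y_0, ..., y_(v-1).         *)
Definition xvar (i : 'I_v) : {mpoly K[v + v]} := 'X_(lshift v i).
Definition yvar (i : 'I_v) : {mpoly K[v + v]} := 'X_(rshift v i).

Definition binomial_edge_ideal (e : rel 'I_v) : {pred {mpoly K[v + v]}^o} :=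
  ideal_gen (fun f => exists i j : 'I_v,
    [/\ (i < j)%N, e i j & f = xvar i * yvar j - xvar j * yvar i]).

End BinomialEdgeIdeal.

Arguments binomial_edge_ideal K {v} e.

(* The two sides are {0, ..., m-1} and {m, ..., m+n-1}.                       *)
Definition complete_bipartite (m n : nat) : rel 'I_(m + n) :=
  [rel i j : 'I_(m + n) | (i < m)%N != (j < m)%N].

Arguments complete_bipartite : clear implicits.

Definition in_J_Kmn (K : fieldType) (m n : nat) :
    submodClosed {mpoly K[(m + n) + (m + n)]}^o :=
  initial_ideal (binomial_edge_ideal K (complete_bipartite m n)).

(* Main.v *)
Require Import Defs.
From HB Require Import structures.
From mathcomp Require Import all_boot all_order all_algebra.
From mathcomp Require Import boolp mpoly zify ring.
From Stdlib Require ClassicalEpsilon.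

Set Implicit Arguments.
Unset Strict Implicit.
Unset Printing Implicit Defensive.

Import Order.TTheory GRing.Theory.
Local Open Scope ring_scope.

(** Write the variables of the first side as [a_i = x_i], [b_i = y_i] and those
    of the second side as [c_k], [d_k].  The initial ideal is the squarefree
    monomial ideal generated by
    - [a_i d_k],
    - [a_i b_j c_k] with [i < j],
    - [b_i c_k d_l] with [k < l].
    This is the intersection of the ideal of all [x_i y_j] with [i < j], the
    ideal of the variables of the first side and the ideal of those of the
    second side ([in_pred], [in_pred_gen]).  Each monomial of the intersection is
    the leading monomial of a multiple of a [2 x 2] minor lying in [J]
    ([in_pred_lead]).  Conversely, [J] lies in the ideals of the variables of
    both sides and in the kernel of [x_i |-> s z_i], [y_i |-> t z_i]; a monomial
    that no [x_i y_j] with [i < j] divides is the smallest of its fibre under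
    this map, so it cannot lead an element of the kernel ([lead_in_pred]).

    Listed in the above order, lexicographically within each family, the
    generators have linear quotients: the ideal of the earlier generators has
    as colon by a generator [g] an ideal generated by a set [V g] of variables,
    where [V g] has (counting indices from 0) [i + k], [n + (j - 1) + k] and
    [m + i + (l - 1)] elements in the three families ([colon_fwd], [colon_bwd],
    [card_colon_vars]).  Iterated mapping cones over Koszul complexes
    ([mapping_cone], [koszul_resolution]) then give a minimal graded free
    resolution, with [\sum_g 'C(#|V g|, i)] basis vectors in homological degree
    [i] of the ideal, those from [g] in degree [i + deg g]
    ([squarefree_linear_quotients]).  Hence the projective dimension of the
    ideal is the largest [#|V g|], no Betti number lies beyond the strand of the
    cubic generators, and the corner Betti number counts the cubic generators
    with the largest [#|V g|].  These are the [n - 1] monomials [b_m c_k d_n]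
    when [n > 1], together with the [m - 1] monomials [a_i b_m c_n] when [n = 1]
    or [m = n].

    Finally the Betti numbers and the projective dimension, defined through
    arbitrary resolutions, are read off a minimal one by comparing resolutions
    up to homotopy ([betti_minimal], [projdim_minimal]). *)

(** * Homogeneous components and homogeneous matrices *)

Section Homogeneous.
Variables (K : fieldType) (N : nat).
Local Notation S := {mpoly K[N]}.

(** Both cases of the definition at once: in a negative degree only 0, whose
    support is empty, is homogeneous. *)
Lemma homog_degP (d : int) (f : S) :
  homog_deg d f <-> forall u, u \in msupp f -> d = (mdeg u)%:Z.
Proof.
case: d => [e|e] /=; split.
- by move/dhomogP=> h u /h <-.
- by move=> h; apply/dhomogP => u /h [].
- by move=> -> u; rewrite msupp0.
- move=> h; apply/eqP; rewrite -msupp_eq0.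
  by case: (msupp f) h => // u s /(_ u); rewrite mem_head => /(_ isT).
Qed.

Lemma homog_degX u (d : int) : d = (mdeg u)%:Z -> homog_deg d ('X_[u] : S).
Proof. by move=> ->; rewrite /= dhomogX. Qed.

Lemma homog_deg0 (d : int) : homog_deg d (0 : S).
Proof. by apply/homog_degP => u; rewrite msupp0. Qed.

Lemma homog_degD (d : int) (f g : S) :
  homog_deg d f -> homog_deg d g -> homog_deg d (f + g).
Proof.
move=> /homog_degP hf /homog_degP hg; apply/homog_degP => u /msuppD_le.
by rewrite mem_cat => /orP [/hf|/hg].
Qed.

Lemma homog_degN (d : int) (f : S) : homog_deg d f -> homog_deg d (- f).
Proof.
by move=> /homog_degP hf; apply/homog_degP => u; rewrite (perm_mem (msuppN f)) => /hf.
Qed.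

Lemma homog_deg_sum (d : int) (I : Type) (r : seq I) (P : pred I) (F : I -> S) :
  (forall i, P i -> homog_deg d (F i)) -> homog_deg d (\sum_(i <- r | P i) F i).
Proof.
by move=> h; apply: big_ind => //; [exact: homog_deg0 | exact: homog_degD].
Qed.

Lemma homog_degM (d e : int) (f g : S) :
  homog_deg d f -> homog_deg e g -> homog_deg (d + e) (f * g).
Proof.
move=> /homog_degP hf /homog_degP hg; apply/homog_degP => u /msuppM_le.
by move=> /allpairsP [[v w] /= [/hf -> /hg -> ->]]; rewrite mdegD PoszD.
Qed.

Lemma homog_deg_gt0 (d : int) (f : S) : homog_deg d f -> d != 0 -> f@_0%MM = 0.
Proof.
move=> /homog_degP hf d0; apply: memN_msupp_eq0; apply/negP => /hf.
by rewrite mdeg0 => /eqP; rewrite (negPf d0).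
Qed.

Definition hcomp (d : int) (f : S) : S :=
  if d is Posz e then pihomog mdeg e f else 0.

Lemma hcompP d f : homog_deg d (hcomp d f).
Proof. by case: d => e //=; apply: pihomogP. Qed.

Lemma hcomp_id d f : homog_deg d f -> hcomp d f = f.
Proof. by case: d => e; [exact: pihomog_dE | move=> ->]. Qed.

Lemma hcomp_is_linear d : linear (hcomp d).
Proof.
move=> c f g; case: d => [e|e]; first exact: linearP.
by rewrite /= scaler0 addr0.
Qed.

HB.instance Definition _ d :=
  GRing.isLinear.Build K S S _ (hcomp d) (hcomp_is_linear d).

Lemma hcomp_eq0 d e f : homog_deg e f -> d <> e -> hcomp d f = 0.
Proof.
case: e => e /=; case: d => d //= h ne; last by rewrite h raddf0.
by apply: pihomog_ne0 h; apply/eqP => E; apply: ne; rewrite E.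
Qed.

(** Components commute with multiplication by a homogeneous factor, which is
    what makes homogeneous linear systems solvable degree by degree. *)
Lemma hcompMr d e f g : homog_deg e g -> hcomp d (f * g) = hcomp (d - e) f * g.
Proof.
move=> hg; rewrite [f]mpolyE mulr_suml !linear_sum mulr_suml.
apply: eq_bigr => u _; rewrite -scalerAl !linearZ /= -scalerAl; congr (_ *: _).
have hX : homog_deg (mdeg u)%:Z ('X_[u] : S) by apply: homog_degX.
have [E|E] := eqVneq (d - e) (mdeg u)%:Z.
  rewrite !hcomp_id ?E //.
  by have := homog_degM hX hg; rewrite -E subrK.
rewrite (hcomp_eq0 hX) ?mul0r; last exact/eqP.
by rewrite (hcomp_eq0 (homog_degM hX hg)) // => E'; rewrite E' addrK eqxx in E.
Qed.

Lemma hcomp_msupp d f u : u \in msupp (hcomp d f) -> u \in msupp f.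
Proof.
case: d => [d|d] /=; last by rewrite msupp0.
rewrite pihomogE => /msupp_sum_le /flattenP [s /mapP [v]].
by rewrite mem_filter => /andP [_ vf] -> /msuppZ_le; rewrite msuppX inE => /eqP ->.
Qed.

Definition homog_mx p q (a : 'I_p -> int) (b : 'I_q -> int) (A : 'M[S]_(p, q)) :=
  forall k l, homog_deg (a k - b l) (A k l).

Lemma homog_mxD p q (a : 'I_p -> int) (b : 'I_q -> int) A B :
  homog_mx a b A -> homog_mx a b B -> homog_mx a b (A + B).
Proof. by move=> hA hB k l; rewrite mxE; apply: homog_degD. Qed.

Lemma homog_mxN p q (a : 'I_p -> int) (b : 'I_q -> int) A :
  homog_mx a b A -> homog_mx a b (- A).
Proof. by move=> hA k l; rewrite mxE; apply: homog_degN. Qed.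

Lemma homog_mxM p q r (a : 'I_p -> int) (b : 'I_q -> int) (c : 'I_r -> int) A B :
  homog_mx a b A -> homog_mx b c B -> homog_mx a c (A *m B).
Proof.
move=> hA hB k l; rewrite mxE; apply: homog_deg_sum => i _.
by have := homog_degM (hA k i) (hB i l); rewrite addrA subrK.
Qed.

Lemma homog_mx1 p (a : 'I_p -> int) : homog_mx a a 1%:M.
Proof.
move=> k l; rewrite mxE; case: eqVneq => [->|_] /=; last exact: homog_deg0.
by rewrite subrr /=; apply: dhomog1.
Qed.

Lemma homog_mx_shift p q (a : 'I_p -> int) (b : 'I_q -> int) s A :
  homog_mx a b A -> homog_mx (fun k => a k + s) (fun l => b l + s) A.
Proof. by move=> hA k l; rewrite /= opprD addrACA subrr addr0. Qed.

(** The components of the right degrees of any solution of a homogeneous linear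
    system form again a solution. *)
Lemma homog_lift p q r (c : 'I_r -> int) (a : 'I_p -> int) (b : 'I_q -> int)
    (A : 'M[S]_(p, q)) (Y : 'M[S]_(r, q)) :
  homog_mx a b A -> homog_mx c b Y ->
  (forall k, exists w, row k Y = w *m A) ->
  exists2 W, homog_mx c a W & Y = W *m A.
Proof.
move=> hA hY /choice [w wP].
exists (\matrix_(k, l) hcomp (c k - a l) (w k 0 l)).
  by move=> k l; rewrite mxE; apply: hcompP.
apply/matrixP => k l; have /matrixP /(_ 0 l) := wP k; rewrite !mxE => E.
rewrite -(hcomp_id (hY k l)) E linear_sum; apply: eq_bigr => i _ /=.
by rewrite (hcompMr _ _ (hA i l)) mxE; congr (hcomp _ _ * _); lia.
Qed.

End Homogeneous.

(** Chain maps and homotopies are built one degree at a time: [P] is the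
    invariant that makes the next step [Q] possible. *)
Lemma dependent_choice (A : nat -> Type) (P : forall i, A i -> Prop)
    (Q : forall i, A i -> A i.+1 -> Prop) (a0 : A 0%N) :
  P 0%N a0 ->
  (forall i a, P i a -> exists a', P i.+1 a' /\ Q i a a') ->
  exists f : forall i, A i,
    [/\ f 0%N = a0, forall i, P i (f i) & forall i, Q i (f i) (f i.+1)].
Proof.
move=> Pa0 step.
pose nxt i (s : {a : A i | P i a}) : {a : A i.+1 | P i.+1 a} :=
  let e := cid (step i (sval s) (svalP s)) in exist _ (sval e) (svalP e).1.
pose g := fix g i : {a : A i | P i a} :=
  if i is i'.+1 then nxt i' (g i') else exist _ a0 Pa0.
exists (fun i => sval (g i)); split=> // i; first exact: svalP (g i).
exact: (svalP (cid (step i (sval (g i)) (svalP (g i))))).2.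
Qed.

(** * Comparison of graded free resolutions *)

Section Comparison.
Variables (K : fieldType) (N : nat).
Local Notation S := {mpoly K[N]}.

Definition graded_complex (F : free_complex K N) :=
  forall i, homog_mx (@fdeg _ _ F i.+1) (@fdeg _ _ F i) (fdiff F i).

Definition acyclic (F : free_complex K N) :=
  forall i (v : 'rV[S]_(frank F i.+1)),
    v *m fdiff F i = 0 <-> exists w, v = w *m fdiff F i.+1.

Lemma acyclic_complex F i : acyclic F -> fdiff F i.+1 *m fdiff F i = 0.
Proof.
move=> aF; apply/row_matrixP => k; rewrite row_mul row0.
by apply/(aF i); exists (delta_mx 0 k); rewrite rowE.
Qed.

(** Comparison theorem.  The shift [s] of degrees is needed for multiplication
    by a monomial, which is lifted to build mapping cones. *)
Lemma chain_lift (F F' : free_complex K N) (s : int)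
    (psi0 : 'M[S]_(frank F 0, frank F' 0)) :
  graded_complex F -> graded_complex F' -> acyclic F' ->
  (forall i, fdiff F i.+1 *m fdiff F i = 0) ->
  homog_mx (fun k => fdeg k + s) (@fdeg _ _ F' 0) psi0 ->
  (forall v : 'rV_(frank F 1), exists w, v *m fdiff F 0 *m psi0 = w *m fdiff F' 0) ->
  exists psi : forall i, 'M[S]_(frank F i, frank F' i),
    [/\ psi 0%N = psi0,
        forall i, homog_mx (fun k => fdeg k + s) (@fdeg _ _ F' i) (psi i)
      & forall i, fdiff F i *m psi i = psi i.+1 *m fdiff F' i].
Proof.
move=> gF gF' aF' cF hpsi0 psi0P.
pose P i (psi : 'M[S]_(frank F i, frank F' i)) :=
  homog_mx (fun k => fdeg k + s) (@fdeg _ _ F' i) psi /\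
  forall v : 'rV_(frank F i.+1), exists w, v *m fdiff F i *m psi = w *m fdiff F' i.
pose Q i (psi : 'M[S]_(frank F i, frank F' i))
    (psi' : 'M[S]_(frank F i.+1, frank F' i.+1)) :=
  fdiff F i *m psi = psi' *m fdiff F' i.
have [//|i psi [hpsi psiP]|psi [E PP QQ]] := @dependent_choice _ P Q psi0.
  have [W hW E] : exists2 W : 'M[S]_(frank F i.+1, frank F' i.+1),
      homog_mx (fun k => fdeg k + s) (@fdeg _ _ F' i.+1) W
      & fdiff F i *m psi = W *m fdiff F' i.
    apply: homog_lift (gF' i) _ _.
      by apply: homog_mxM hpsi; apply: homog_mx_shift.
    move=> k; rewrite row_mul rowE; exact: psiP.
  exists W; split=> //; split=> // v; apply/(aF' i).
  by rewrite -mulmxA -E !mulmxA -(mulmxA v) cF mulmx0 mul0mx.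
by exists psi; split=> // i; case: (PP i).
Qed.

(** A chain map that is zero on homology in degree 0 is null-homotopic.  The
    induction carries that [phi i - h i d] is killed by the incoming
    differential, so that it factors through the next one. *)
Lemma chain_homotopy (F F' : free_complex K N)
    (phi : forall i, 'M[S]_(frank F i, frank F' i)) :
  graded_complex F -> graded_complex F' -> acyclic F' ->
  (forall i, fdiff F i.+1 *m fdiff F i = 0) ->
  (forall i, homog_mx (@fdeg _ _ F i) (@fdeg _ _ F' i) (phi i)) ->
  (forall i, fdiff F i *m phi i = phi i.+1 *m fdiff F' i) ->
  (forall v : 'rV_(frank F 0), exists w, v *m phi 0%N = w *m fdiff F' 0) ->
  exists h : forall i, 'M[S]_(frank F i, frank F' i.+1),
    [/\ forall i, homog_mx (@fdeg _ _ F i) (@fdeg _ _ F' i.+1) (h i),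
        phi 0%N = h 0%N *m fdiff F' 0
      & forall i, phi i.+1 = h i.+1 *m fdiff F' i.+1 + fdiff F i *m h i].
Proof.
move=> gF gF' aF' cF hphi cphi phi0.
have [h0 hh0 E0] : exists2 W : 'M[S]_(frank F 0, frank F' 1),
    homog_mx (@fdeg _ _ F 0) (@fdeg _ _ F' 1) W & phi 0%N = W *m fdiff F' 0.
  by apply: homog_lift (gF' 0%N) (hphi 0%N) _ => k; rewrite rowE.
pose P i (h : 'M[S]_(frank F i, frank F' i.+1)) :=
  homog_mx (@fdeg _ _ F i) (@fdeg _ _ F' i.+1) h /\
  fdiff F i *m (phi i - h *m fdiff F' i) = 0.
pose Q i (h : 'M[S]_(frank F i, frank F' i.+1))
    (h' : 'M[S]_(frank F i.+1, frank F' i.+2)) :=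
  phi i.+1 = h' *m fdiff F' i.+1 + fdiff F i *m h.
have [|i h [hh hP]|h [E PP QQ]] := @dependent_choice _ P Q h0.
- by split=> //; rewrite -E0 subrr mulmx0.
- have [W hW E] : exists2 W : 'M[S]_(frank F i.+1, frank F' i.+2),
      homog_mx (@fdeg _ _ F i.+1) (@fdeg _ _ F' i.+2) W
      & phi i.+1 - fdiff F i *m h = W *m fdiff F' i.+1.
    apply: homog_lift (gF' i.+1) _ _.
      apply: homog_mxD (hphi _) _; apply: homog_mxN; exact: homog_mxM (gF i) hh.
    move=> k; apply/(aF' i); rewrite -row_mul mulmxBl -cphi -mulmxA -mulmxBr hP.
    by rewrite row0.
  exists W; split; last by rewrite /Q -E subrK.
  by split=> //; rewrite -E opprB addrC subrK mulmxA cF mul0mx.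
exists h; split=> //; last by rewrite E.
by move=> i; case: (PP i).
Qed.

End Comparison.
(** * Betti numbers read off a minimal resolution *)

Section StrandRank.

(** The matrix [B] of the inclusion of the coordinates in [a] has
    [B B^T = 1], and the diagonal matrix is [B^T B]. *)
Lemma rank_diag_mx_bool (K : fieldType) n (a : pred 'I_n) :
  \rank (diag_mx (\row_k (a k)%:R : 'rV[K]_n)) = #|a|.
Proof.
pose B : 'M[K]_(#|a|, n) := \matrix_(i, k) (enum_val i == k)%:R.
have BB : B *m B^T = 1%:M.
  apply/matrixP => i j; rewrite !mxE (bigD1 (enum_val i)) //= !mxE eqxx mul1r.
  rewrite big1 ?addr0 => [|k ne]; first by rewrite (inj_eq enum_val_inj) eq_sym.
  by rewrite !mxE eq_sym (negPf ne) mul0r.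
have ED : diag_mx (\row_k (a k)%:R) = B^T *m B.
  apply/matrixP => k l; rewrite !mxE.
  have [ak|nak] := boolP (k \in a); last first.
    rewrite unfold_in in nak; rewrite (negPf nak) mul0rn big1 // => i _.
    rewrite !mxE; case: eqP => [E|_]; last by rewrite mul0r.
    by have := enum_valP i; rewrite E unfold_in (negPf nak).
  rewrite (bigD1 (enum_rank_in ak k)) //= !mxE enum_rankK_in // eqxx mul1r.
  rewrite big1 ?addr0 => [|i ne]; first by rewrite unfold_in in ak; rewrite ak.
  rewrite !mxE; case: eqP => [E|_]; last by rewrite mul0r.
  by case/eqP: ne; apply: enum_val_inj; rewrite enum_rankK_in.
apply/eqP; rewrite eqn_leq; apply/andP; split.
  by rewrite ED; apply: leq_trans (mxrankM_maxr _ _) (rank_leq_row _).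
have rB : \rank B = #|a|.
  apply/eqP; rewrite eqn_leq rank_leq_row /= -{1}(mxrank1 K #|a|) -BB.
  exact: mxrankM_maxl.
rewrite -{1}rB; have <- : B *m (B^T *m B) = B by rewrite mulmxA BB mul1mx.
by rewrite -ED mxrankM_maxr.
Qed.

End StrandRank.

Section BettiMinimal.
Variables (K : fieldType) (N : nat).
Local Notation S := {mpoly K[N]}.

(** Tensoring with [K] over the polynomial ring. *)
Definition const_mx0 p q (A : 'M[S]_(p, q)) : 'M[K]_(p, q) := map_mx (mcoeff 0%MM) A.

Lemma const_mx0M p q r (A : 'M[S]_(p, q)) (B : 'M[S]_(q, r)) :
  const_mx0 (A *m B) = const_mx0 A *m const_mx0 B.
Proof. exact: map_mxM. Qed.

Definition strand_mx p (a : 'I_p -> int) (j : int) : 'M[K]_p :=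
  diag_mx (\row_k (a k == j)%:R).

(** A homogeneous matrix modulo the variables preserves degrees: an entry of
    nonzero degree has no constant term. *)
Lemma strand_mx_homog p q (a : 'I_p -> int) (b : 'I_q -> int) j (A : 'M[S]_(p, q)) :
  homog_mx a b A -> strand_mx a j *m const_mx0 A = const_mx0 A *m strand_mx b j.
Proof.
move=> hA; apply/matrixP => k l; rewrite mul_diag_mx mul_mx_diag !mxE.
have [E|ne] := eqVneq (a k) (b l); first by rewrite E mulrC.
by rewrite (homog_deg_gt0 (hA k l)) ?subr_eq0 // mulr0 mul0r.
Qed.

(** What is used of a grading: when a combination of homogeneous elements is
    homogeneous, its coefficients may be replaced by their components of the
    expected degrees. *)
Definition has_components (M : lmodType S) (gr : int -> M -> Prop) :=
  forall n (y : 'I_n -> M) (e : 'I_n -> int) (w : 'I_n -> S) (d : int),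
    (forall l, gr (e l) (y l)) -> gr d (\sum_l w l *: y l) ->
    \sum_l w l *: y l = \sum_l hcomp (d - e l) (w l) *: y l.

Lemma linear_row (M : lmodType S) n (f : {linear 'rV[S]_n -> M}) v :
  f v = \sum_l v 0 l *: f (delta_mx 0 l).
Proof. by rewrite {1}(row_sum_delta v) linear_sum; apply: eq_bigr => l _; rewrite linearZ. Qed.

Lemma augmentation_lift (M : lmodType S) (gr : int -> M -> Prop) p q
    (a : 'I_p -> int) (b : 'I_q -> int)
    (f : {linear 'rV[S]_p -> M}) (g : {linear 'rV[S]_q -> M}) :
  has_components gr ->
  (forall k, gr (a k) (f (delta_mx 0 k))) ->
  (forall l, gr (b l) (g (delta_mx 0 l))) ->
  surj g ->
  exists psi : 'M[S]_(p, q), homog_mx a b psi /\ forall v, g (v *m psi) = f v.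
Proof.
move=> hc hf hg sg.
have /choice [w wP] : forall k, exists w, g w = f (delta_mx 0 k) by move=> k; apply: sg.
exists (\matrix_(k, l) hcomp (a k - b l) (w k 0 l)); split.
  by move=> k l; rewrite mxE; apply: hcompP.
move=> v; rewrite [v in LHS]row_sum_delta mulmx_suml linear_sum [RHS]linear_row.
apply: eq_bigr => k _; rewrite -scalemxAl linearZ /=; congr (_ *: _).
rewrite -rowE linear_row -wP [g (w k)]linear_row.
rewrite (hc _ _ _ (w k 0) (a k) hg); last by rewrite -linear_row wP.
by apply: eq_bigr => l _; rewrite !mxE.
Qed.

Variables (M : lmodType S) (gr : int -> M -> Prop).
Hypothesis gr_components : has_components gr.

Definition graded_chain_map (F F' : free_complex K N)
    (f : forall i, 'M[S]_(frank F i, frank F' i)) :=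
  forall i, homog_mx (@fdeg _ _ F i) (@fdeg _ _ F' i) (f i)
    /\ fdiff F i *m f i = f i.+1 *m fdiff F' i.

Definition homotopic_to_id (F : free_complex K N)
    (f : forall i, 'M[S]_(frank F i)) :=
  exists h : forall i, 'M[S]_(frank F i, frank F i.+1),
    [/\ forall i, homog_mx (@fdeg _ _ F i) (@fdeg _ _ F i.+1) (h i),
        1%:M - f 0%N = h 0%N *m fdiff F 0
      & forall i, 1%:M - f i.+1 = h i.+1 *m fdiff F i.+1 + fdiff F i *m h i].

(** Two graded free resolutions of the same module are homotopy equivalent, by
    maps of degree 0. *)
Lemma resolution_homotopy (F F' : free_complex K N) :
  graded_free_resolution gr F -> graded_free_resolution gr F' ->
  exists (f : forall i, 'M[S]_(frank F i, frank F' i))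
         (g : forall i, 'M[S]_(frank F' i, frank F i)),
   [/\ graded_chain_map f, graded_chain_map g,
       homotopic_to_id (fun i => f i *m g i)
     & homotopic_to_id (fun i => g i *m f i)].
Proof.
move=> [e [ge gF se ke aF]] [e' [ge' gF' se' ke' aF']].
have shift0 p q (a : 'I_p -> int) (b : 'I_q -> int) A :
    homog_mx (fun k => a k + 0) b A <-> homog_mx a b A.
  by split=> hA k l; have := hA k l; rewrite addr0.
have lift (G G' : free_complex K N) (eG : {linear 'rV_(frank G 0) -> M})
    (eG' : {linear 'rV_(frank G' 0) -> M}) :
    graded_complex G -> graded_complex G' -> acyclic G -> acyclic G' ->
    (forall k, gr (fdeg k) (eG (delta_mx 0 k))) ->
    (forall k, gr (fdeg k) (eG' (delta_mx 0 k))) ->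
    surj eG' ->
    (forall v, eG v = 0 <-> exists w, v = w *m fdiff G 0) ->
    (forall v, eG' v = 0 <-> exists w, v = w *m fdiff G' 0) ->
    exists f : forall i, 'M[S]_(frank G i, frank G' i),
      (forall v, eG' (v *m f 0%N) = eG v) /\ graded_chain_map f.
  move=> gG gG' aG aG' hG hG' sG' kG kG'.
  have [f0 [hf0 f0P]] := augmentation_lift gr_components hG hG' sG'.
  have [|||f [E hf cf]] := @chain_lift _ _ G G' 0 f0 gG gG' aG'.
  - by move=> i; apply: acyclic_complex.
  - exact/shift0.
  - by move=> v; apply/kG'; rewrite f0P; apply/kG; exists v.
  exists f; split=> [v|i]; first by rewrite E f0P.
  by split=> //; apply/shift0.
have homot (G : free_complex K N) (eG : {linear 'rV_(frank G 0) -> M})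
    (f : forall i, 'M[S]_(frank G i)) :
    graded_complex G -> acyclic G ->
    (forall v, eG v = 0 <-> exists w, v = w *m fdiff G 0) ->
    graded_chain_map f -> (forall v, eG (v *m f 0%N) = eG v) -> homotopic_to_id f.
  move=> gG aG kG hf f0.
  have [||||h [hh h0 hS]] := @chain_homotopy _ _ G G (fun i => 1%:M - f i) gG gG aG.
  - by move=> i; apply: acyclic_complex.
  - move=> i; apply: homog_mxD; first exact: homog_mx1.
    by apply: homog_mxN; apply: (hf i).1.
  - by move=> i; rewrite mulmxBr mulmxBl mul1mx mulmx1 (hf i).2.
  - by move=> v; apply/kG; rewrite mulmxBr mulmx1 linearB /= f0 subrr.
  by exists h.
have comp (G G' : free_complex K N) (f : forall i, 'M[S]_(frank G i, frank G' i))
    (g : forall i, 'M[S]_(frank G' i, frank G i)) :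
    graded_chain_map f -> graded_chain_map g ->
    graded_chain_map (fun i => f i *m g i).
  move=> hf hg i; split; first exact: homog_mxM (hf i).1 (hg i).1.
  by rewrite mulmxA (hf i).2 -mulmxA (hg i).2 mulmxA.
have [f [f0 hf]] := lift F F' e e' gF gF' aF aF' ge ge' se' ke ke'.
have [g [g0 hg]] := lift F' F e' e gF' gF aF' aF ge' ge se ke' ke.
exists f, g; split=> //.
  by apply: (homot F e) => //; [exact: comp | move=> v; rewrite mulmxA g0 f0].
by apply: (homot F' e') => //; [exact: comp | move=> v; rewrite mulmxA f0 g0].
Qed.

Definition minimal_complex (F : free_complex K N) := forall i, tensK F i = 0.

(** Let [f : F -> F'], [g : F' -> F] be homotopy inverse.  Modulo the variables
    the differential of [F'] vanishes, so [f] after [g] is the identity of [F'], [f]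
    kills boundaries and [g] takes values in cycles; by the homotopy on [F], a
    cycle killed by [f] is a boundary.  Hence [f] identifies homology with the
    strand of [F']. *)
Lemma homology_dim_minimal (F F' : free_complex K N) i j :
  graded_free_resolution gr F -> graded_free_resolution gr F' ->
  minimal_complex F' ->
  homology_dim F i j = #|[pred k : 'I_(frank F' i) | fdeg k == j]|.
Proof.
move=> rF rF' mF'.
have gF : graded_complex F by case: rF => e [].
have aF : acyclic F by case: rF => e [].
have [f [g [hf hg [h [hh h0 hS]] [h' [_ h'0 h'S]]]]] := resolution_homotopy rF rF'.
pose fb i := const_mx0 (f i); pose gb i := const_mx0 (g i); pose hb i := const_mx0 (h i).
have const1 n : const_mx0 (1%:M : 'M[S]_n) = 1%:M by exact: map_mx1.
have constB p q (A B : 'M[S]_(p, q)) : const_mx0 (A - B) = const_mx0 A - const_mx0 B.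
  exact: map_mxB.
have constD p q (A B : 'M[S]_(p, q)) : const_mx0 (A + B) = const_mx0 A + const_mx0 B.
  exact: map_mxD.
have tE (G : free_complex K N) k : tensK G k = const_mx0 (fdiff G k) by [].
have sf : strand F i j *m fb i = fb i *m strand F' i j by exact: strand_mx_homog (hf i).1.
have sg : strand F' i j *m gb i = gb i *m strand F i j by exact: strand_mx_homog (hg i).1.
have gf : gb i *m fb i = 1%:M.
  apply/eqP; rewrite eq_sym -subr_eq0 -const_mx0M -const1 -constB; apply/eqP.
  case: (i) => [|k]; first by rewrite h'0 const_mx0M -tE mF' mulmx0.
  by rewrite h'S constD !const_mx0M -!tE !mF' mulmx0 mul0mx addr0.
have tf k : tensK F k *m fb k = 0.
  by rewrite tE -const_mx0M (hf k).2 const_mx0M -tE mF' mulmx0.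
have gt k : gb k.+1 *m tensK F k = 0.
  by rewrite tE -const_mx0M -(hg k).2 const_mx0M -tE mF' mul0mx.
have cyc : (cycles F i j <= strand F i j)%MS.
  by rewrite /cycles; case: (i) => [|k] //=; apply: capmxSl.
have Zsub : (strand F' i j *m gb i <= cycles F i j)%MS.
  rewrite sg /cycles; case: (i) => [|k] /=; first exact: submxMl.
  rewrite sub_capmx submxMl; apply/sub_kermxP.
  rewrite -(strand_mx_homog j (hg k.+1).1) -mulmxA.
  by rewrite (gt k) mulmx0.
have Bsub : (boundaries F i j <= cycles F i j)%MS.
  rewrite /boundaries (strand_mx_homog j (gF i)).
  case: (i) => [|k]; first exact: submxMl.
  rewrite /= sub_capmx submxMl; apply/sub_kermxP.
  rewrite -(strand_mx_homog j (gF k.+1)) -mulmxA -const_mx0M acyclic_complex //.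
  by rewrite /const_mx0 map_mx0 mulmx0.
have fbn (z : 'rV[K]_(frank F i)) : (z <= cycles F i j)%MS -> z *m fb i = 0 ->
    (z <= boundaries F i j)%MS.
  move=> zZ zf.
  have zs : z *m strand F i j = z.
    have /submxP [D ->] := submx_trans zZ cyc; rewrite -mulmxA; congr (_ *m _).
    apply/matrixP => k l; rewrite mul_diag_mx !mxE.
    by case: (fdeg k == j); rewrite ?mul1r // mul0r mul0rn.
  have zh : z = z *m hb i *m tensK F i.
    have -> : z *m hb i *m tensK F i = z *m const_mx0 (1%:M - f i *m g i).
      rewrite tE -mulmxA -const_mx0M; move: z zZ {zf zs}; case: (i) => [|k] z zZ.
        by rewrite h0.
      rewrite hS constD mulmxDr [const_mx0 (fdiff F k *m _)]const_mx0M mulmxA -tE.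
      have /sub_kermxP -> : (z <= kermx (tensK F k))%MS.
        by apply: submx_trans zZ (capmxSr _ _).
      by rewrite mul0mx addr0.
    by rewrite constB const1 const_mx0M mulmxBr mulmx1 mulmxA zf mul0mx subr0.
  rewrite zh -{1}zs -(mulmxA z) (strand_mx_homog j (hh i)) mulmxA -mulmxA.
  exact: submxMl.
rewrite -(rank_diag_mx_bool K) -[diag_mx _]/(strand F' i j) /homology_dim.
have ZE : (cycles F i j *m fb i :=: strand F' i j)%MS.
  apply/eqmxP/andP; split.
    have /submxP [D ->] := cyc; rewrite -mulmxA sf mulmxA; exact: submxMl.
  have /(submxMr (fb i)) := Zsub; by rewrite -mulmxA gf mulmx1.
rewrite -(mxrank_mul_ker (cycles F i j) (fb i)) ZE.
have -> : \rank (cycles F i j :&: kermx (fb i)) = \rank (boundaries F i j).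
  apply/eqmx_rank/andP; split.
    apply/row_subP => k; apply: fbn.
      by apply: submx_trans (capmxSl _ _); apply: row_sub.
    by apply/sub_kermxP; apply: submx_trans (row_sub _ _) (capmxSr _ _).
  rewrite sub_capmx Bsub; apply/sub_kermxP.
  by rewrite /boundaries -mulmxA tf mulmx0.
by rewrite addnK.
Qed.

Theorem betti_minimal (F : free_complex K N) i j :
  graded_free_resolution gr F -> minimal_complex F ->
  betti gr i j = #|[pred k : 'I_(frank F i) | fdeg k == j]|.
Proof.
move=> rF mF; apply: homology_dim_minimal => //.
by apply: ClassicalEpsilon.epsilon_spec; exists F.
Qed.

End BettiMinimal.
(** * Projective dimension read off a minimal resolution *)

Section ProjectiveComparison.
Variable R : comNzRingType.

(** A linear map into a submodule, which turns exactness into the surjectivity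
    that the definition of projective modules asks for. *)
Section Corestriction.
Variables (A B : lmodType R) (U : submodClosed B) (f : {linear A -> B}).
Hypothesis fU : forall a, f a \in U.

Definition corestrict (a : A) : submod U := SubMod (fU a).

Fact corestrict_is_linear : linear corestrict.
Proof. by move=> c a b; apply: val_inj; rewrite /= linearP. Qed.

HB.instance Definition _ :=
  GRing.isLinear.Build R A (submod U) _ corestrict corestrict_is_linear.

End Corestriction.

Section Image.
Variables (A B : lmodType R) (f : {linear A -> B}).

Definition image_pred : {pred B} := fun b => `[< exists a, f a = b >].

Fact image_pred_submod : submod_closed image_pred.
Proof.
split=> [|c _ _ /asboolP [a <-] /asboolP [b <-]]; apply/asboolP.
  by exists 0; rewrite linear0.
by exists (c *: a + b); rewrite linearP.
Qed.

HB.instance Definition _ :=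
  GRing.isSubmodClosed.Build R B image_pred image_pred_submod.

End Image.

Lemma projective_lift (Q A B : lmodType R) (f : {linear A -> B})
    (phi : {linear Q -> B}) :
  projective Q -> (forall q, exists a, f a = phi q) ->
  exists psi : {linear Q -> A}, forall q, f (psi q) = phi q.
Proof.
move=> pQ phi_im.
have fI a : f a \in image_pred f by apply/asboolP; exists a.
have pI q : phi q \in image_pred f by apply/asboolP.
have [b|psi psiP] := pQ _ _ (corestrict fI) (corestrict pI).
  have /asboolP [a ab] := valP b; exists a; exact: val_inj.
by exists psi => q; have /(congr1 val) := psiP q.
Qed.

Variables (M : lmodType R) (A B : nat -> lmodType R).
Variables (dA : forall i, {linear A i.+1 -> A i}) (dB : forall i, {linear B i.+1 -> B i}).
Variables (eA : {linear A 0%N -> M}) (eB : {linear B 0%N -> M}).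
Hypothesis pA : forall i, projective (A i).
Hypothesis exA : forall i, exact_at (dA i.+1) (dA i).
Hypothesis exB : forall i, exact_at (dB i.+1) (dB i).
Hypothesis exB0 : exact_at (dB 0%N) eB.

(** The comparison theorem for arbitrary projective modules, without gradings;
    it is needed as [proj_resolution_le] ranges over all projective
    resolutions. *)
Lemma projective_chain_lift : exact_at (dA 0%N) eA -> surj eB ->
  exists f : forall i, {linear A i -> B i},
    (forall x, eB (f 0%N x) = eA x) /\
    forall i x, dB i (f i.+1 x) = f i (dA i x).
Proof.
move=> exA0 sB; have [f0 f0P] := projective_lift (@pA 0%N) (fun q => sB (eA q)).
pose P i (f : {linear A i -> B i}) := forall x, exists y, dB i y = f (dA i x).
pose Q i (f : {linear A i -> B i}) (f' : {linear A i.+1 -> B i.+1}) :=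
  forall x, dB i (f' x) = f (dA i x).
have [x|i f fP|f [fE _ fQ]] := @dependent_choice _ P Q f0.
- by apply/exB0; rewrite f0P; apply/exA0; exists x.
- have [f' f'P] := @projective_lift _ _ _ (dB i) (f \o dA i) (@pA i.+1) fP.
  exists f'; split=> // x; apply/exB; rewrite f'P /=.
  have -> : dA i (dA i.+1 x) = 0 by apply/exA; exists x.
  by rewrite linear0.
by exists f; split=> // x; rewrite fE f0P.
Qed.

Lemma projective_chain_homotopy (f : forall i, {linear A i -> B i}) :
  (forall i x, dB i (f i.+1 x) = f i (dA i x)) ->
  (forall x, eB (f 0%N x) = 0) ->
  exists h : forall i, {linear A i -> B i.+1},
    forall i x, f i.+1 x = dB i.+1 (h i.+1 x) + h i (dA i x).
Proof.
move=> cf f0; have [h0 h0P] := projective_lift (@pA 0%N) (fun q => (exB0 (f 0%N q)).1 (f0 q)).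
pose P i (h : {linear A i -> B i.+1}) :=
  forall x, dB i (h (dA i x)) = f i (dA i x).
pose Q i (h : {linear A i -> B i.+1}) (h' : {linear A i.+1 -> B i.+2}) :=
  forall x, f i.+1 x = dB i.+1 (h' x) + h (dA i x).
have [x|i h hP|h [_ _ hQ]] := @dependent_choice _ P Q h0; last by exists h.
- by rewrite h0P.
- have [|h' h'P] := @projective_lift _ _ _ (dB i.+1) (f i.+1 \- (h \o dA i)) (@pA i.+1).
    by move=> x; apply/exB; rewrite linearB /= hP cf subrr.
  exists h'; split=> x; last by rewrite h'P /= subrK.
  rewrite h'P /=; have -> : dA i (dA i.+1 x) = 0 by apply/exA; exists x.
  by rewrite linear0 subr0.
Qed.

End ProjectiveComparison.

Section ProjdimMinimal.
Variables (K : fieldType) (N : nat).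
Local Notation S := {mpoly K[N]}.

Lemma row_projective n : projective ('rV[S]_n : lmodType S).
Proof.
move=> A B g f sg; have /choice [a aP] := fun k => sg (f (delta_mx 0 k)).
have lin : linear (fun v : 'rV[S]_n => \sum_k v 0 k *: a k).
  move=> c u v; rewrite scaler_sumr -big_split; apply: eq_bigr => k _ /=.
  by rewrite !mxE scalerDl scalerA.
pose hm := GRing.isLinear.Build S 'rV[S]_n A _ (fun v => \sum_k v 0 k *: a k) lin.
pose h : {linear 'rV[S]_n -> A} := HB.pack (fun v : 'rV[S]_n => \sum_k v 0 k *: a k) hm.
exists h => v; rewrite [RHS]linear_row /= linear_sum; apply: eq_bigr => k _.
by rewrite linearZ aP.
Qed.

Lemma projdim_uniq (M : lmodType S) n : is_projdim M n -> projdim M = n.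
Proof.
move=> nP; have [le1 min1] := ClassicalEpsilon.epsilon_spec (inhabits 0%N) _ (ex_intro _ n nP).
case: nP => le2 min2; rewrite /projdim.
by case: (ltngtP (projdim M) n) => // [/min2|/min1]; rewrite ?/projdim; case.
Qed.

(** Suppose [P] is a projective resolution of length [k < n].  The composite
    [F -> P -> F] is homotopic to the identity and is zero in degree [n] as
    [P n = 0]; so the identity of [F n] is [d h + h d], which vanishes modulo the
    variables, although [F n] is not zero. *)
Lemma projdim_minimal (M : lmodType S) (F : free_complex K N)
    (e : {linear 'rV[S]_(frank F 0) -> M}) n :
  surj e -> (forall v, e v = 0 <-> exists w, v = w *m fdiff F 0) ->
  acyclic F -> minimal_complex F ->
  (0 < frank F n)%N -> (forall i, (n < i)%N -> frank F i = 0%N) ->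
  projdim M = n.
Proof.
move=> se ke aF mF Fn Fgt; apply: projdim_uniq.
pose A i : lmodType S := 'rV[S]_(frank F i).
pose dA i : {linear A i.+1 -> A i} := mulmxr (fdiff F i).
have pA i : projective (A i) by apply: row_projective.
have exA i : exact_at (dA i.+1) (dA i).
  move=> v; split=> [/aF [w ->]|[w wE]]; first by exists w.
  by apply/aF; exists w; rewrite -wE.
have exA0 : exact_at (dA 0%N) e.
  move=> v; split=> [/ke [w ->]|[w wE]]; first by exists w.
  by apply/ke; exists w; rewrite -wE.
split.
  exists A, dA, e; split=> // i /Fgt ri; rewrite /A; move: ri => -> x.
  by apply/rowP => -[].
move=> k kn [P [dP [eP [pP [sP exP0] exP P0]]]].
have [f [f0 fS]] := projective_chain_lift pA exA exP exP0 exA0 sP.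
have [g [g0 gS]] := projective_chain_lift pP exP exA exA0 exP0 se.
pose phi i : {linear A i -> A i} := idfun \- (g i \o f i).
have [||h hP] := @projective_chain_homotopy _ M A A dA dA e pA exA exA exA0 phi.
- move=> i x; transitivity (dA i x - dA i (g i.+1 (f i.+1 x))).
    exact: (linearB (dA i)).
  by rewrite gS fS.
- by move=> x; rewrite /phi linearB /= g0 f0 subrr.
case: n Fn Fgt kn => // n Fn Fgt kn.
pose k0 : 'I_(frank F n.+1) := Ordinal Fn.
have := hP n (delta_mx 0 k0); rewrite /phi /= (P0 _ kn (f _ _)) linear0 subr0.
rewrite /dA /=.
have hE i (v : 'rV[S]_(frank F i)) : h i v = v *m lin1_mx (h i) by rewrite mul_rV_lin1.
rewrite (hE n.+1) (hE n) => /(congr1 (@const_mx0 K N _ _)).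
rewrite [const_mx0 (_ + _)]map_mxD -!/(const_mx0 _) !const_mx0M.
have mE i : const_mx0 (fdiff F i) = 0 := mF i.
rewrite !mE !mulmx0 mul0mx addr0.
move/matrixP => /(_ 0 k0); rewrite !mxE !eqxx /= mcoeff1 eqxx => /eqP.
by rewrite oner_eq0.
Qed.

End ProjdimMinimal.
(** * Monomial ideals and mapping cones *)

Section MonomialIdeal.
Variables (K : fieldType) (N : nat).
Local Notation S := {mpoly K[N]}.
Implicit Types (P Q : 'X_{1..N} -> Prop) (f g : S).

(** An ideal generated by monomials is given by the set [P] of the monomials
    that it contains, so that colons and sums are computed on exponents. *)
Definition mon_ideal P f := forall u, u \in msupp f -> P u.

Definition up_closed P := forall u v, P u -> P (u + v)%MM.

Lemma mon_ideal0 P : mon_ideal P 0.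
Proof. by move=> u; rewrite msupp0. Qed.

Lemma mon_idealD P f g : mon_ideal P f -> mon_ideal P g -> mon_ideal P (f + g).
Proof. by move=> hf hg u /msuppD_le; rewrite mem_cat => /orP [/hf|/hg]. Qed.

Lemma mon_idealN P f : mon_ideal P f -> mon_ideal P (- f).
Proof. by move=> hf u; rewrite (perm_mem (msuppN f)) => /hf. Qed.

Lemma mon_ideal_sum P (I : Type) (r : seq I) (A : pred I) (F : I -> S) :
  (forall i, A i -> mon_ideal P (F i)) -> mon_ideal P (\sum_(i <- r | A i) F i).
Proof. by move=> h; apply: big_ind => //; [exact: mon_ideal0 | exact: mon_idealD]. Qed.

Lemma mon_idealM P f g : up_closed P -> mon_ideal P g -> mon_ideal P (f * g).
Proof.
move=> uP hg u /msuppM_le /allpairsP [[v w] /= [_ /hg Pw ->]].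
by rewrite addmC; apply: uP.
Qed.

Lemma mon_idealX P u : mon_ideal P 'X_[u] <-> P u.
Proof.
split=> [|Pu v]; last by rewrite msuppX inE => /eqP ->.
by apply; rewrite msuppX inE.
Qed.

Lemma mon_ideal_colon P Q (g : 'X_{1..N}) f : (forall u, Q u <-> P (g + u)%MM) ->
  mon_ideal P (f * 'X_[g]) <-> mon_ideal Q f.
Proof.
move=> QP; split=> h u.
  by move=> uf; apply/QP/h; rewrite (perm_mem (msuppMX _ _)) map_f.
by rewrite (perm_mem (msuppMX _ _)) => /mapP [v vf ->]; apply/QP/h.
Qed.

Lemma mon_ideal_add P P' (g : 'X_{1..N}) f : up_closed P ->
  (forall u, P' u <-> P u \/ (g <= u)%MM) ->
  mon_ideal P' f <-> exists q, mon_ideal P (f - q * 'X_[g]).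
Proof.
move=> uP P'E; split=> [hf|[q hq]]; last first.
  rewrite -(subrK (q * 'X_[g]) f); apply: mon_idealD => [u /hq Pu|u].
    by apply/P'E; left.
  rewrite (perm_mem (msuppMX _ _)) => /mapP [v _ ->].
  by apply/P'E; right; apply: lem_addr.
exists (\sum_(u <- msupp f | (g <= u)%MM) f@_u *: 'X_[u - g]).
rewrite {1}[f]mpolyE (bigID (fun u => (g <= u)%MM)) /= mulr_suml addrC.
rewrite [X in _ + X - _](eq_bigr (fun u => f@_u *: 'X_[u - g] * 'X_[g])); last first.
  by move=> u gu; rewrite -scalerAl -mpolyXD submK.
rewrite addrK big_seq_cond; apply: mon_ideal_sum => u /andP [/hf /P'E Pu ngu] v.
move=> /msuppZ_le; rewrite msuppX inE => /eqP ->.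
by case: Pu => // gu; rewrite gu in ngu.
Qed.

End MonomialIdeal.

Section MappingCone.
Variables (K : fieldType) (N : nat).
Local Notation S := {mpoly K[N]}.

(** If [G], with augmentation [a] to the ring [S], resolves the ideal [I], then
    [splice a] is the complex [... -> G_1 -> G_0 -> S], which resolves [S / I]. *)
Definition splice (G : free_complex K N) (a : 'cV[S]_(frank G 0)) : free_complex K N :=
  @FreeComplex K N (fun i => if i is i'.+1 then frank G i' else 1%N)
    (fun i => match i return 'I_(if i is i'.+1 then frank G i' else 1%N) -> int with
              | 0%N => fun=> 0
              | i'.+1 => @fdeg _ _ G i' end)
    (fun i => match i return 'M[S]_(frank G i, if i is i'.+1 then frank G i' else 1%N) with
              | 0%N => a
              | i'.+1 => fdiff G i' end).

Definition deg_count (G : free_complex K N) i (j : int) : nat :=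
  #|[pred k : 'I_(frank G i) | fdeg k == j]|.

Definition minimal_ideal_resolution (P : 'X_{1..N} -> Prop)
    (G : free_complex K N) (a : 'cV[S]_(frank G 0)) :=
  [/\ graded_complex (splice a), acyclic (splice a), minimal_complex (splice a)
    & forall v : 'rV[S]_1, mon_ideal P (v 0 0) <-> exists w, v = w *m a].

(** [b i j] is the number of basis vectors of degree [j] in homological degree
    [i] of the resolution of the ideal. *)
Definition has_resolution P (b : nat -> int -> nat) :=
  exists G (a : 'cV[S]_(frank G 0)),
    minimal_ideal_resolution P a /\ forall i j, deg_count G i j = b i j.

(** The same count for the quotient by the ideal. *)
Definition quot_count (b : nat -> int -> nat) i (j : int) : nat :=
  if i is i'.+1 then b i' j else (j == 0).

Lemma deg_count_splice (G : free_complex K N) (a : 'cV[S]_(frank G 0)) i j :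
  deg_count (splice a) i j = quot_count (deg_count G) i j.
Proof.
case: i => [|i] //; rewrite /deg_count /= eq_sym; case: (j == 0).
  by rewrite (eq_card (B := predT)) ?card_ord.
by rewrite eq_card0.
Qed.

Lemma deg_count_gt0 (G : free_complex K N) i (k : 'I_(frank G i)) :
  deg_count G i (fdeg k) != 0%N.
Proof. by rewrite -lt0n; apply/card_gt0P; exists k; rewrite inE. Qed.

Lemma has_resolution_ext P P' b b' :
  (forall u, P u <-> P' u) -> (forall i j, b i j = b' i j) ->
  has_resolution P b -> has_resolution P' b'.
Proof.
move=> PE bE; have -> : P = P' by apply/funext => u; apply/propext.
by have -> : b = b' by apply/funext => i; apply/funext => j.
Qed.

Lemma has_resolution0 : has_resolution (fun=> False) (fun _ _ => 0%N).
Proof.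
pose G := @FreeComplex K N (fun=> 0%N) (fun _ _ => 0) (fun=> 0).
exists G, (0 : 'M_(0, 1)); split.
  split.
  - by case=> [|i] [].
  - case=> [|i] v; split=> _; try by exists 0; apply/matrixP => ? [].
      by rewrite [LHS]mulmx0.
    by apply/matrixP => ? [].
  - by move=> i; apply/matrixP; case: i => [|i] [].
  move=> v; split=> [h|[w ->]].
    exists 0; rewrite mul0mx; apply/matrixP => k l; rewrite mxE !ord1.
    apply/eqP; rewrite -msupp_eq0.
    move: h; rewrite /mon_ideal; case: (msupp (v 0 0)) => // u s /(_ u).
    by rewrite mem_head => /(_ isT).
  by rewrite mulmx0 mxE; apply: mon_ideal0.
by move=> i j; rewrite /deg_count eq_card0 // => -[].
Qed.

(** The mapping cone of multiplication by [g], lifted to [psi] from the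
    resolution of the quotient by the colon ideal [Q = (P : g)] to that of the
    quotient by [P].  The base ring in degree 0 of the latter is left out, so that the
    cone resolves the ideal [P' = P + (g)] itself. *)
Section Cone.
Variables (G H : free_complex K N) (a : 'cV[S]_(frank G 0)) (c : 'cV[S]_(frank H 0)).
Variables (g : 'X_{1..N}).
Variable psi : forall i, 'M[S]_(frank (splice c) i, frank (splice a) i).

Definition cone_deg i (k : 'I_(frank G i + frank (splice c) i)) : int :=
  match split k with
  | inl l => fdeg l
  | inr l => fdeg l + (mdeg g)%:Z
  end.

Definition cone : free_complex K N :=
  @FreeComplex K N (fun i => frank G i + frank (splice c) i)%N cone_deg
    (fun i => block_mx (fdiff G i) 0 (psi i.+1) (- fdiff (splice c) i)).

Definition cone_aug : 'cV[S]_(frank cone 0) := col_mx a (psi 0%N).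

Lemma deg_count_cone i j :
  deg_count cone i j =
    (deg_count G i j + quot_count (deg_count H) i (j - (mdeg g)%:Z))%N.
Proof.
rewrite -(deg_count_splice c) /deg_count -!sum1_card.
rewrite big_split_ord /=; congr (_ + _)%N; apply: eq_bigl => k; rewrite !inE /=.
  by rewrite /cone_deg (unsplitK (inl k)).
by rewrite /cone_deg (unsplitK (inr k)) eq_sym -subr_eq eq_sym.
Qed.

Variables P Q P' : 'X_{1..N} -> Prop.
Hypothesis uP : up_closed P.
Hypothesis QE : forall u, Q u <-> P (g + u)%MM.
Hypothesis P'E : forall u, P' u <-> P u \/ (g <= u)%MM.
Hypothesis resP : minimal_ideal_resolution P a.
Hypothesis resQ : minimal_ideal_resolution Q c.
Hypothesis psi0 : psi 0%N = ('X_[g])%:M.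
Hypothesis psi_homog : forall i,
  homog_mx (fun k => fdeg k + (mdeg g)%:Z) (@fdeg _ _ (splice a) i) (psi i).
Hypothesis psi_chain : forall i,
  fdiff (splice c) i *m psi i = psi i.+1 *m fdiff (splice a) i.
Hypothesis g_gt0 : (0 < mdeg g)%N.
(* Makes all entries of [psi] of positive degree, hence the cone minimal. *)
Hypothesis deg_gap : forall i (k : 'I_(frank H i)) (l : 'I_(frank G i)),
  fdeg l < fdeg k + (mdeg g)%:Z.

(** The step common to all homological degrees: subtracting a boundary reduces
    a cycle of the cone to a cycle of the target of [psi]. *)
Lemma cone_exact i (v1 : 'rV[S]_(frank G i)) (v2 : 'rV[S]_(frank (splice c) i)) :
  v1 *m fdiff (splice a) i + v2 *m psi i = 0 ->
  (exists w, v2 = w *m fdiff (splice c) i) ->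
  exists w, row_mx v1 v2 = w *m fdiff cone i.
Proof.
have [_ aG _ _] := resP.
move=> v0 [w v2E]; have /aG [w' w'E] : (v1 + w *m psi i.+1) *m fdiff (splice a) i = 0.
  by rewrite mulmxDl -mulmxA -psi_chain mulmxA -v2E.
exists (row_mx w' (- w)); rewrite mul_row_block mulmx0 add0r mulmxN !mulNmx opprK -v2E.
congr (row_mx _ _); have -> : w' *m fdiff G i = v1 + w *m psi i.+1 by rewrite w'E.
by rewrite addrK.
Qed.

Lemma cone_acyclic : acyclic (splice cone_aug).
Proof.
have [_ aG _ iG] := resP; have [_ aH _ iH] := resQ.
case=> [|i] v; split.
- rewrite -[v]hsubmxK => v0.
  have {}v0 : lsubmx v *m a + rsubmx v *m psi 0%N = 0 by rewrite -mul_row_col.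
  have [|w wE] := @cone_exact 0 _ _ v0; last by exists w.
  apply/iH.
  apply/(mon_ideal_colon (rsubmx v 0 0) QE).
  have -> : rsubmx v 0 0 * 'X_[g] = (- (lsubmx v *m a) : 'rV[S]_1) 0 0.
    move/eqP: v0; rewrite addrC addr_eq0 psi0 mul_mx_scalar => /eqP <-.
    by rewrite [RHS]mxE mulrC.
  by rewrite mxE; apply: mon_idealN; apply/iG; exists (lsubmx v).
- case=> w ->; rewrite -mulmxA; have -> : fdiff (splice cone_aug) 1 *m fdiff (splice cone_aug) 0 = 0.
    rewrite /= mul_block_col mul0mx addr0 mulNmx.
    have /= -> := psi_chain 0; rewrite subrr.
    by have /= -> := @acyclic_complex _ _ _ 0%N aG; rewrite col_mx0.
  by rewrite mulmx0.
- rewrite -[v]hsubmxK /= mul_row_block mulmx0 add0r => /(congr1 (fun x => (lsubmx x, rsubmx x))).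
  rewrite !row_mxKl !row_mxKr linear0 linear0 => -[v0 v1].
  have [|w wE] := @cone_exact i.+1 _ _ v0; last by exists w.
  apply/aH; move/eqP: v1; rewrite mulmxN oppr_eq0 => /eqP.
  by [].
- case=> w ->; rewrite -mulmxA.
  have -> : fdiff (splice cone_aug) i.+2 *m fdiff (splice cone_aug) i.+1 = 0.
    rewrite /= mulmx_block !mulmxN !mulNmx opprK !mulmx0 !mul0mx oppr0 !addr0 !add0r.
    have /= -> := psi_chain i.+1; rewrite subrr.
    have /= -> := @acyclic_complex _ _ _ i.+1 aG.
    by have /= -> := @acyclic_complex _ _ _ i aH; rewrite block_mx0.
  by rewrite mulmx0.
Qed.

Lemma cone_resolution : minimal_ideal_resolution P' cone_aug.
Proof.
have [hG aG mG iG] := resP; have [hH aH mH iH] := resQ.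
have cgl i (k : 'I_(frank G i)) : @cone_deg i (lshift _ k) = fdeg k.
  by rewrite /cone_deg (unsplitK (inl k)).
have cgr i (k : 'I_(frank (splice c) i)) :
    @cone_deg i (rshift _ k) = fdeg k + (mdeg g)%:Z.
  by rewrite /cone_deg (unsplitK (inr k)).
split.
- case=> [|i] k l /=.
    rewrite -(splitK k) /unsplit; case: (split k) => k'.
      by rewrite col_mxEu cgl; have := hG 0%N k' l.
    by rewrite col_mxEd cgr; have := @psi_homog 0%N k' l.
  rewrite -(splitK k) -(splitK l) /unsplit.
  case: (split k) => k'; case: (split l) => l'.
  + by rewrite block_mxEul !cgl; have := hG i.+1 k' l'.
  + by rewrite block_mxEur mxE; apply: homog_deg0.
  + by rewrite block_mxEdl cgl cgr; have := @psi_homog i.+1 k' l'.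
  + rewrite block_mxEdr !cgr mxE opprD addrACA subrr addr0.
    by apply: homog_degN; have := hH i k' l'.
- exact: cone_acyclic.
- have psi_min i : const_mx0 (psi i) = 0.
    case: i => [|i]; apply/matrixP => k l; rewrite !mxE.
      rewrite psi0 mxE !ord1 eqxx mulr1n mcoeffX.
      by case: eqP => // E; move: g_gt0; rewrite E mdeg0.
    apply: homog_deg_gt0 (@psi_homog i.+1 k l) _.
    by rewrite subr_eq0; have /= := @deg_gap i k l; rewrite lt_neqAle eq_sym => /andP [].
  case=> [|i]; rewrite /tensK /=.
    rewrite map_col_mx (_ : map_mx _ a = 0); last exact: (mG 0%N).
    by rewrite (_ : map_mx _ _ = 0) ?col_mx0 //; exact: (psi_min 0%N).
  rewrite map_block_mx map_mx0 map_mxN.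
  rewrite (_ : map_mx _ (fdiff G i) = 0); last exact: (mG i.+1).
  rewrite (_ : map_mx _ (psi i.+1) = 0); last exact: (psi_min i.+1).
  rewrite (_ : map_mx _ _ = 0); last exact: (mH i).
  by rewrite oppr0 block_mx0.
- move=> v; apply: (iff_trans (mon_ideal_add _ uP P'E)); split.
    case=> q hq; have [|w wE] := (iG (v - (q * 'X_[g])%:M)).1 _.
      by rewrite !mxE eqxx mulr1n.
    exists (row_mx w q%:M); rewrite mul_row_col -wE psi0 -scalar_mxM.
    by rewrite subrK.
  case=> w ->; rewrite -[w]hsubmxK mul_row_col psi0.
  exists (rsubmx w 0 0).
  have -> : (lsubmx w *m a + rsubmx w *m ('X_[g])%:M) 0 0 - rsubmx w 0 0 * 'X_[g] =
      (lsubmx w *m a) 0 0.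
    have entryD (A B : 'rV[S]_1) : (A + B) 0 0 = A 0 0 + B 0 0 by rewrite mxE.
    have entryZ x (A : 'rV[S]_1) : (x *: A) 0 0 = A 0 0 * x by rewrite mxE mulrC.
    by rewrite entryD mul_mx_scalar entryZ addrK.
  by apply/iG; exists (lsubmx w).
Qed.

End Cone.

(** The exact sequence [0 -> S/Q -> S/P -> S/P' -> 0], where the first map is
    multiplication by [g], turns resolutions of [Q = (P : g)] and [P] into one of
    [P' = P + (g)].  The last condition, on the degrees of the basis vectors,
    keeps it minimal. *)
Theorem mapping_cone (P Q P' : 'X_{1..N} -> Prop) (g : 'X_{1..N}) b c :
  up_closed P ->
  (forall u, Q u <-> P (g + u)%MM) ->
  (forall u, P' u <-> P u \/ (g <= u)%MM) ->
  (0 < mdeg g)%N ->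
  (forall i j j', b i j != 0%N -> c i j' != 0%N -> j < j' + (mdeg g)%:Z) ->
  has_resolution P b -> has_resolution Q c ->
  has_resolution P' (fun i j => b i j + quot_count c i (j - (mdeg g)%:Z))%N.
Proof.
move=> uP QE P'E g0 gap [G [a [rG bE]]] [H [e [rH cE]]].
have [hG aG mG iG] := rG; have [hH aH mH iH] := rH.
have [|||psi [p0 ph pc]] := @chain_lift _ _ (splice e) (splice a) (mdeg g)%:Z ('X_[g])%:M hH hG aG.
- by move=> i; apply: acyclic_complex.
- move=> k l; rewrite !ord1 mxE eqxx mulr1n add0r subr0.
  exact: homog_degX.
- move=> v; apply/iG; rewrite mul_mx_scalar mxE mulrC.
  by apply/(mon_ideal_colon _ QE)/iH; exists v.
exists (cone g psi), (cone_aug g psi); split; last first.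
  move=> i j; rewrite deg_count_cone bE; congr (_ + _)%N.
  by case: i => //= i; rewrite cE.
apply: (cone_resolution uP QE P'E rG rH) => // i k l.
by apply: (gap i); rewrite -?bE -?cE; apply: deg_count_gt0.
Qed.

End MappingCone.
(** * Linear quotients *)

Section LinearQuotients.
Variables (K : fieldType) (N : nat).
Local Notation S := {mpoly K[N]}.

Lemma lem_mnm1 (x : 'I_N) (u : 'X_{1..N}) : (U_(x) <= u)%MM = (0 < u x)%N.
Proof.
apply/mnm_lepP/idP => [/(_ x)|ux y]; first by rewrite mnm1E eqxx.
by rewrite mnm1E; case: eqP => [<-|].
Qed.

(** The Koszul complex, built as an iterated mapping cone: each variable is
    regular modulo the previous ones, so the colon ideal is the ideal itself. *)
Lemma koszul_resolution (V : seq 'I_N) : uniq V ->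
  has_resolution K (fun u : 'X_{1..N} => exists2 x, x \in V & (0 < u x)%N)
    (fun i j => 'C(size V, i.+1) * (j == i.+1))%N.
Proof.
elim: V => [|x V IHV] /= => [_|/andP [xV uV]].
  apply: has_resolution_ext (has_resolution0 K N) => [u|i j]; last by rewrite mul0n.
  by split=> // -[].
pose P (u : 'X_{1..N}) := exists2 y, y \in V & (0 < u y)%N.
have uP : up_closed P.
  by move=> u v [y yV uy]; exists y => //; rewrite mnmDE addn_gt0 uy.
have IH := IHV uV.
pose P' u := P u \/ (U_(x) <= u)%MM.
apply: has_resolution_ext (mapping_cone (P' := P') (g := U_(x)%MM) uP _ _ _ _ IH IH).
- move=> u; split=> [[[y yV uy]|]|[y]].
  + by exists y; rewrite // inE yV orbT.
  + by rewrite lem_mnm1 => ux; exists x; rewrite // mem_head.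
  + rewrite inE => /orP [/eqP ->|yV] uy; last by left; exists y.
    by right; rewrite lem_mnm1.
- move=> i j; rewrite mdeg1 binS mulnDl; congr (_ + _)%N.
  case: i => [|i] /=; first by rewrite bin0 mul1n subr_eq0.
  by congr (_ * _)%N; rewrite subr_eq -(PoszD _ 1) addn1.
- move=> u; split=> [[y yV uy]|[y yV]].
    by exists y => //; rewrite mnmDE mnm1E addn_gt0 uy orbT.
  rewrite mnmDE mnm1E; case: eqP => [E|_]; last by exists y.
  by rewrite E yV in xV.
- by [].
- by rewrite mdeg1.
- move=> i j j'; rewrite !muln_eq0 !negb_or !eqb0 !negbK mdeg1.
  by move=> /andP [_ /eqP ->] /andP [_ /eqP ->]; lia.
Qed.

(** Ideals with linear quotients: adding the generators [mon t] one at a time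
    in the order of [rk] (an index that may skip values), each step is a mapping
    cone over the Koszul complex on [V t].  As degrees do not decrease along
    [rk], all cones are minimal. *)
Theorem linear_quotients_resolution (T : finType) (A : pred T)
    (mon : T -> 'X_{1..N}) (V : T -> {set 'I_N}) (rk : T -> nat) :
  {in A &, injective rk} ->
  (forall t, A t -> (0 < mdeg (mon t))%N) ->
  (forall s t, A s -> A t -> (rk s < rk t)%N -> (mdeg (mon s) <= mdeg (mon t))%N) ->
  (forall t (u : 'X_{1..N}), A t ->
     (exists2 x, x \in V t & (0 < u x)%N) <->
     exists s, [/\ A s, (rk s < rk t)%N & (mon s <= mon t + u)%MM]) ->
  has_resolution K (fun u : 'X_{1..N} => exists2 t, A t & (mon t <= u)%MM)
    (fun i j => \sum_(t | A t) 'C(#|V t|, i) * (j == (i + mdeg (mon t))%N))%N.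
Proof.
move=> rk_inj mon_gt0 mon_le colon.
pose P n (u : 'X_{1..N}) := exists2 t, A t && (rk t < n)%N & (mon t <= u)%MM.
pose b n i (j : int) :=
  (\sum_(t | A t && (rk t < n)) 'C(#|V t|, i) * (j == (i + mdeg (mon t))%N))%N.
suff res n : has_resolution K (P n) (b n).
  have bnd t : (rk t < (\max_t rk t).+1)%N by rewrite ltnS (leq_bigmax t).
  apply: has_resolution_ext (res (\max_t rk t).+1) => [u|i j].
    by split=> -[t At tu]; exists t => //; [case/andP: At | rewrite At bnd].
  by apply: eq_bigl => t; rewrite bnd andbT.
elim: n => [|n IHn].
  apply: has_resolution_ext (has_resolution0 K N) => [u|i j].
    by split=> // -[t]; rewrite andbF.
  by rewrite /b big_pred0 // => t; rewrite andbF.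
case: (pickP (fun t => A t && (rk t == n))) => [t /andP [At /eqP rt]|none]; last first.
  have E t : A t && (rk t < n.+1)%N = A t && (rk t < n)%N.
    by rewrite ltnS leq_eqVlt andb_orr none.
  apply: has_resolution_ext IHn => [u|i j]; last by apply: eq_bigl => t; rewrite E.
  by split=> -[t At tu]; exists t; rewrite // ?E // -E.
have E s : A s && (rk s < n.+1)%N = (A s && (rk s < n)%N) || (s == t).
  rewrite ltnS leq_eqVlt andb_orr orbC; congr (_ || _).
  apply/andP/eqP => [[As /eqP rs]|->]; last by rewrite At rt.
  by apply: rk_inj => //; rewrite rs rt.
have uP : up_closed (P n).
  by move=> u v [s As su]; exists s => //; apply: lepm_trans su (lem_addr _ _).
pose P' u := P n u \/ (mon t <= u)%MM.
have kV := koszul_resolution (enum_uniq (V t)).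
apply: has_resolution_ext (mapping_cone (P' := P') (g := mon t) uP _ _ _ _ IHn kV).
- move=> u; split=> [[[s As su]|tu]|[s]].
  + by exists s => //; rewrite E As.
  + by exists t => //; rewrite E eqxx orbT.
  + by rewrite E => /orP [As su|/eqP ->]; [left; exists s | right].
- move=> i j; rewrite /b [RHS](bigD1 t) /=; last by rewrite At rt leqnn.
  rewrite addnC; congr (_ + _)%N.
    rewrite -cardE; case: i => [|i] /=; first by rewrite bin0 mul1n subr_eq0.
    by congr (_ * _)%N; rewrite subr_eq -PoszD.
  apply: eq_bigl => s; rewrite E; case: eqP => [->|]; last by rewrite orbF andbT.
  by rewrite rt ltnn !andbF.
- move=> u; split=> [[x]|[s /andP [As rs] su]].
    rewrite mem_enum => xV ux; have [s [As rs su]] := (colon t u At).1 (ex_intro2 _ _ x xV ux).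
    by exists s => //; rewrite As -rt.
  have [|x xV ux] := (colon t u At).2; first by exists s; rewrite rt.
  by exists x; rewrite // mem_enum.
- by [].
- exact: mon_gt0.
- move=> i j j'; rewrite !muln_eq0 !negb_or !eqb0 !negbK => b0 /andP [_ /eqP ->].
  have [s /andP [As rs]] : exists2 s, A s && (rk s < n)%N & j == (i + mdeg (mon s))%N.
    apply/exists_inP; apply: contraNT b0 => /exists_inPn none.
    rewrite /b big1 // => s As; have := none s As; by case: eqP => //; rewrite muln0.
  by move/eqP ->; have := mon_le s t As At; rewrite rt rs => /(_ isT); lia.
Qed.

Definition sqfree_mon (A : {set 'I_N}) : 'X_{1..N} := [multinom (x \in A : nat) | x < N].

Lemma mdeg_sqfree_mon A : mdeg (sqfree_mon A) = #|A|.
Proof.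
rewrite mdegE (eq_bigr (fun x => (x \in A : nat))) => [|x _]; last by rewrite mnmE.
by rewrite -sum1_card [RHS]big_mkcond /=; apply: eq_bigr => x _; case: (x \in A).
Qed.

Lemma sqfree_mon_le A u : (sqfree_mon A <= u)%MM <-> forall x, x \in A -> (0 < u x)%N.
Proof.
split=> [/mnm_lepP h x xA|h]; first by have := h x; rewrite mnmE xA.
by apply/mnm_lepP => x; rewrite mnmE; case: (boolP (x \in A)) => // /h.
Qed.

(** For squarefree monomials the condition on colon ideals is a condition on
    supports: every earlier generator involves a variable of [V t] that [t] does
    not, and every variable of [V t] times [mon t] is a multiple of an earlier
    generator. *)
Theorem squarefree_linear_quotients (T : finType) (A : pred T)
    (supp : T -> {set 'I_N}) (V : T -> {set 'I_N}) (rk : T -> nat) :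
  {in A &, injective rk} ->
  (forall t, A t -> (0 < #|supp t|)%N) ->
  (forall s t, A s -> A t -> (rk s < rk t)%N -> (#|supp s| <= #|supp t|)%N) ->
  (forall s t, A s -> A t -> (rk s < rk t)%N ->
     exists x, [/\ x \in supp s, x \in V t & x \notin supp t]) ->
  (forall t x, A t -> x \in V t ->
     exists s, [/\ A s, (rk s < rk t)%N & supp s \subset x |: supp t]) ->
  has_resolution K (fun u : 'X_{1..N} => exists2 t, A t & forall x, x \in supp t -> (0 < u x)%N)
    (fun i j => \sum_(t | A t) 'C(#|V t|, i) * (j == (i + #|supp t|)%N))%N.
Proof.
move=> rk_inj s_gt0 s_le fwd bwd.
apply: has_resolution_ext
  (linear_quotients_resolution (mon := sqfree_mon \o supp) rk_inj _ _ (V := V) _).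
- by move=> u; split=> -[t At /sqfree_mon_le tu]; exists t.
- by move=> i j; apply: eq_bigr => t _; rewrite /= mdeg_sqfree_mon.
- by move=> t At; rewrite /= mdeg_sqfree_mon s_gt0.
- by move=> s t As At st; rewrite /= !mdeg_sqfree_mon s_le.
move=> t u At; split=> [[x xV ux]|[s [As st /sqfree_mon_le su]]].
  have [s [As st /subsetP ss]] := bwd t x At xV; exists s; split=> //.
  apply/sqfree_mon_le => y /ss; rewrite mnmDE mnmE addn_gt0 !inE.
  by case/orP => [/eqP ->|->] //; rewrite ux orbT.
have [x [xs xV xt]] := fwd s t As At st; exists x => //.
by have := su x xs; rewrite mnmDE mnmE (negPf xt).
Qed.

End LinearQuotients.
(** * The initial ideal *)

Section InitialIdeal.
Variables (K : fieldType) (m n : nat).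
Local Notation v := (m + n)%N.
Local Notation S := {mpoly K[v + v]}.
Local Notation X i := (lshift v i).
Local Notation Y i := (rshift v i).
Local Notation J := (binomial_edge_ideal K (complete_bipartite m n)).

Definition minor (i j : 'I_v) : S := xvar K i * yvar K j - xvar K j * yvar K i.

Definition edge_mon (i j : 'I_v) : 'X_{1..v + v} := (U_(X i) + U_(Y j))%MM.

Lemma minorE i j : minor i j = 'X_[edge_mon i j] - 'X_[edge_mon j i].
Proof. by rewrite /minor /xvar /yvar -!mpolyXD. Qed.

Lemma J_mul (f h : S) : h \in J -> f * h \in J.
Proof. exact: (@rpredZ _ _ J f h). Qed.

Lemma J_minor_lt (i j : 'I_v) : (i < m)%N -> (m <= j)%N -> minor i j \in J.
Proof.
move=> im mj; apply/asboolP; exists 1%N, (fun=> 1), (fun=> minor i j); split.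
  move=> _; exists i, j; split=> //; first exact: leq_trans im mj.
  by rewrite /complete_bipartite /= im ltnNge mj.
by rewrite big_ord1 mul1r.
Qed.

Lemma J_minor (i j : 'I_v) : (i < m)%N != (j < m)%N -> minor i j \in J.
Proof.
case: (ltnP i m) => im; case: (ltnP j m) => jm // _; first exact: J_minor_lt.
have -> : minor i j = -1 * minor j i by rewrite /minor; ring.
exact/J_mul/J_minor_lt.
Qed.

(** For a path [i - k - j], the identities
    [x_k [i,j] = x_j [i,k] - x_i [j,k]] and [y_k [i,j] = y_j [i,k] - y_i [j,k]]
    between minors. *)
Lemma J_minor_path (i j k : 'I_v) (z : S) :
  (i < m)%N != (k < m)%N -> (j < m)%N != (k < m)%N ->
  z = xvar K k \/ z = yvar K k -> z * minor i j \in J.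
Proof.
move=> ik jk zE.
have [p [q ->]] : exists p q, z * minor i j = p * minor i k + q * minor j k.
  case: zE => ->.
    by exists (xvar K j), (- xvar K i); rewrite /minor; ring.
  by exists (yvar K j), (- yvar K i); rewrite /minor; ring.
by apply: (@rpredD _ J); apply/J_mul/J_minor.
Qed.

Lemma lex_lead_minor (w : 'X_{1..v + v}) (i j : 'I_v) : (i < j)%N ->
  lex_lead ('X_[w] * minor i j) (w + edge_mon i j)%MM.
Proof.
move=> ij; rewrite minorE mulrBr -!mpolyXD.
have ne : (X i == X j) = false by rewrite (inj_eq (@lshift_inj _ _)) -val_eqE /= ltn_eqF.
have lt : lex_lt (w + edge_mon j i)%MM (w + edge_mon i j)%MM.
  exists (X i); split=> [k /= ki|].
    rewrite !mnmDE !mnm1E -!val_eqE /=; have := ltn_ord i; lia.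
  rewrite !mnmDE !mnm1E eqxx eq_sym ne -!val_eqE /=; have := ltn_ord i; lia.
have neq : (w + edge_mon j i)%MM != (w + edge_mon i j)%MM.
  apply/eqP => E; case: lt => k [_]; by rewrite E ltnn.
split; first by rewrite mcoeff_msupp mcoeffB !mcoeffX eqxx (negPf neq) subr0 oner_eq0.
move=> b /msuppB_le; rewrite mem_cat !msuppX !inE => /orP [/eqP ->|/eqP ->] //.
Qed.

Definition uses (u : 'X_{1..v + v}) (i : 'I_v) := (0 < u (X i))%N || (0 < u (Y i))%N.

(** The monomials of the intersection of the ideal of all [x_i y_j], [i < j]
    (the initial ideal of all [2 x 2] minors), with the ideals of the variables
    of either side. *)
Definition in_pred (u : 'X_{1..v + v}) : Prop :=
  [/\ exists i j : 'I_v, [/\ (i < j)%N, (0 < u (X i))%N & (0 < u (Y j))%N],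
      exists2 i : 'I_v, (i < m)%N & uses u i
    & exists2 i : 'I_v, (m <= i)%N & uses u i].

Lemma uses_up u w i : uses u i -> uses (u + w)%MM i.
Proof. by rewrite /uses !mnmDE !addn_gt0 => /orP [->|->]; rewrite ?orbT. Qed.

Lemma in_pred_up : up_closed in_pred.
Proof.
move=> u w [[i [j [ij xi yj]]] [k km uk] [l ml ul]]; split.
- by exists i, j; rewrite !mnmDE !addn_gt0 xi yj.
- by exists k => //; apply: uses_up.
- by exists l => //; apply: uses_up.
Qed.

(** Given [i < j] with [x_i y_j] dividing [u], a multiple of the minor [[i,j]] by
    a monomial has leading monomial [u].  It lies in [J] if [i] and [j] are on
    different sides, or if [u] involves [x_k] ([i], [j] on the first side) or
    [y_k] (on the second) for some [k] on the other side; the remaining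
    possibility for [k] provides a pair on different sides. *)
Lemma in_pred_lead u : in_pred u -> exists2 f : S, f \in J & lex_lead f u.
Proof.
move=> [[i [j [ij xi yj]]] [k km uk] [l ml ul]].
have lead (p q : 'I_v) (w : 'X_{1..v + v}) : (p < q)%N -> 'X_[w] * minor p q \in J ->
    u = (w + edge_mon p q)%MM -> exists2 f : S, f \in J & lex_lead f u.
  by move=> pq fJ ->; exists ('X_[w] * minor p q) => //; apply: lex_lead_minor.
have split_mon (p q : 'I_v) : (0 < u (X p))%N -> (0 < u (Y q))%N ->
    u = (u - edge_mon p q + edge_mon p q)%MM.
  move=> xp yq; rewrite submK //; apply/mnm_lepP => s; rewrite mnmDE !mnm1E.
  case: eqP => [<-|_]; first by rewrite eq_rlshift.
  by case: eqP => [<-|].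
have edge (p q : 'I_v) : (p < m)%N -> (m <= q)%N -> (0 < u (X p))%N -> (0 < u (Y q))%N ->
    exists2 f : S, f \in J & lex_lead f u.
  move=> pm mq xp yq; apply: lead (leq_trans pm mq) _ (split_mon _ _ xp yq).
  by apply/J_mul/J_minor_lt.
have via (z : 'I_(v + v)) : ('X_z : S) * minor i j \in J -> z != X i -> z != Y j ->
    (0 < u z)%N -> exists2 f : S, f \in J & lex_lead f u.
  move=> zJ zi zj uz; apply: lead ij _ (split_mon _ _ xi yj).
  have -> : (u - edge_mon i j = (u - edge_mon i j - U_(z)) + U_(z))%MM.
    rewrite submK // lem_mnm1 mnmBE mnmDE !mnm1E eq_sym (negPf zi).
    by rewrite eq_sym (negPf zj) subn0.
  by rewrite mpolyXD -mulrA; apply: J_mul.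
have [im|mi] := ltnP i m.
  have [jm|mj] := ltnP j m; last exact: (edge i j).
  case/orP: ul => [xl|yl]; last exact: (edge i l).
  apply: via xl; last by rewrite eq_lrshift.
    by apply: (J_minor_path (k := l)); rewrite ?im ?jm ?ltnNge ?ml //; left.
  rewrite (inj_eq (@lshift_inj _ _)); apply: contraTneq ml => ->; by rewrite -ltnNge.
have mj : (m <= j)%N := leq_trans mi (ltnW ij).
case/orP: uk => [xk|yk]; first exact: (edge k j).
apply: via yk; first by apply: (J_minor_path (k := k)); rewrite ?km ?ltnNge ?mi ?mj //; right.
  by rewrite eq_rlshift.
by rewrite (inj_eq (@rshift_inj _ _)); apply: contraTneq km => ->; rewrite -leqNgt.
Qed.

(** The exponents of [s] and of the [z_i] in the image of a monomial under
    [x_i |-> s z_i], [y_i |-> t z_i]; together they determine that of [t]. *)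
Definition fibre (u : 'X_{1..v + v}) :=
  (\sum_i u (X i), [ffun i : 'I_v => (u (X i) + u (Y i))%N])%N.

Lemma fibre_edge_mon w i j : fibre (w + edge_mon i j)%MM = fibre (w + edge_mon j i)%MM.
Proof.
rewrite /fibre; congr (_, _).
  have sum1 (p q : 'I_v) : (\sum_r (w + edge_mon p q)%MM (X r) = \sum_r w (X r) + 1)%N.
    rewrite (eq_bigr (fun r => w (X r) + (p == r))%N) => [|r _]; last first.
      by rewrite !mnmDE !mnm1E eq_rlshift (inj_eq (@lshift_inj _ _)) addn0.
    rewrite big_split /=; congr (_ + _)%N; rewrite (bigD1 p) //= eqxx big1 // => r.
    by rewrite eq_sym => /negPf ->.
  by rewrite !sum1.
apply/ffunP => r; rewrite !ffunE !mnmDE !mnm1E !eq_lrshift !eq_rlshift.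
rewrite !(inj_eq (@lshift_inj _ _)) !(inj_eq (@rshift_inj _ _)); lia.
Qed.

(** A coefficient of the image under the same map.  The bound [k] on degrees
    only makes the index set finite. *)
Definition fibre_sum (k : nat) (a : 'X_{1..v + v}) (f : S) : K :=
  \sum_(u : bmultinom (v + v) k | fibre u == fibre a) f@_u.

Lemma fibre_sumX k a u :
  fibre_sum k a 'X_[u] = ((mdeg u < k)%N && (fibre u == fibre a))%:R.
Proof.
rewrite /fibre_sum; have [uk|uk] /= := boolP (mdeg u < k)%N; last first.
  rewrite big1 // => -[w wk] _; rewrite mcoeffX /=; case: eqP => // E.
  by rewrite E wk in uk.
have [uF|uF] /= := boolP (fibre u == fibre a); last first.
  rewrite big1 // => w wF; rewrite mcoeffX; case: eqP => // E.
  by rewrite E wF in uF.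
rewrite (bigD1 (BMultinom uk)) //= mcoeffX eqxx big1 ?addr0 // => w /andP [_ wu].
by rewrite mcoeffX; case: eqP => // E; case/eqP: wu; apply: val_inj; rewrite /= E.
Qed.

Lemma fibre_sum_linear k a (I : Type) (r : seq I) (c : I -> K) (F : I -> S) :
  fibre_sum k a (\sum_(i <- r) c i *: F i) = \sum_(i <- r) c i * fibre_sum k a (F i).
Proof.
rewrite /fibre_sum; under eq_bigr do rewrite raddf_sum /=.
rewrite exchange_big /=; apply: eq_bigr => i _; rewrite mulr_sumr.
by apply: eq_bigr => u _; rewrite mcoeffZ.
Qed.

Lemma fibre_sum_J k a f : f \in J -> fibre_sum k a f = 0.
Proof.
have add f1 f2 : fibre_sum k a (f1 + f2) = fibre_sum k a f1 + fibre_sum k a f2.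
  by rewrite /fibre_sum -big_split; apply: eq_bigr => u _; rewrite mcoeffD.
move=> /asboolP [l [c [g [gP ->]]]].
elim/big_rec: _ => [|i h _ h0]; first by rewrite /fibre_sum big1 // => u _; rewrite mcoeff0.
rewrite add h0 addr0; have [p [q [_ _ ->]]] := gP i.
rewrite -/(minor p q) minorE {1}[c i]mpolyE mulr_suml.
under eq_bigr do rewrite -scalerAl.
rewrite fibre_sum_linear big1_seq // => u _.
rewrite mulrBr -!mpolyXD.
have -> (f1 f2 : S) : fibre_sum k a (f1 - f2) = fibre_sum k a f1 - fibre_sum k a f2.
  by rewrite /fibre_sum -sumrB; apply: eq_bigr => w _; rewrite mcoeffB.
by rewrite !fibre_sumX (fibre_edge_mon u p q) !mdegD !mdeg1 subrr mulr0.
Qed.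

(** A monomial [a] that no [x_i y_j] with [i < j] divides is the smallest of its
    fibre: if [b] first differs from [a] at [x_i], then [a] has no [y_j] for
    [j > i], so its exponents of [x_j] are as large as they can be and [b] has
    too small a degree in the [x_j]. *)
Lemma fibre_min a b : fibre b = fibre a -> lex_lt b a ->
  exists i j : 'I_v, [/\ (i < j)%N, (0 < a (X i))%N & (0 < a (Y j))%N].
Proof.
case=> sumE /ffunP ptE [p [eqp ltp]].
have {}ptE i : (b (X i) + b (Y i) = a (X i) + a (Y i))%N by have := ptE i; rewrite !ffunE.
apply: contrapT => none.
case: (split_ordP p) => i pE; rewrite {}pE in eqp ltp.
  have lt_sum : (\sum_r b (X r) < \sum_r a (X r))%N.
    rewrite (bigD1 i) //= [leqRHS](bigD1 i) //= -addSn leq_add //.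
    apply: leq_sum => r ri; have [lt|le] := ltnP r i; first by rewrite eqp.
    have ir : (i < r)%N by rewrite ltn_neqAle le andbT eq_sym.
    have : a (Y r) = 0%N.
      apply/eqP; rewrite -leqn0 leqNgt; apply/negP => ay; apply: none.
      by exists i, r; split=> //; apply: leq_ltn_trans ltp.
    by have := ptE r; lia.
  by rewrite sumE ltnn in lt_sum.
have := ptE i; rewrite (eqp (X i)); first by lia.
by rewrite /=; have := ltn_ord i; lia.
Qed.

(** If [a] were the smallest monomial of its fibre, no other monomial of [f]
    would be in this fibre, and the sum of the coefficients of [f] over it would be the
    leading coefficient instead of 0. *)
Lemma lead_in_pred (f : S) a : f \in J -> lex_lead f a -> in_pred a.
Proof.
move=> fJ [af amax].
have vars (Q : pred 'I_v) : (forall i j : 'I_v, (i < m)%N != (j < m)%N -> Q i || Q j) ->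
    mon_ideal (fun u => exists2 i, Q i & uses u i) f.
  move=> QP; have upQ : up_closed (fun u => exists2 i, Q i & uses u i).
    by move=> u w [i Qi ui]; exists i => //; apply: uses_up.
  move: fJ => /asboolP [l [c [g [gP ->]]]]; apply: mon_ideal_sum => i _.
  apply: mon_idealM upQ _; have [p [q [_ pq ->]]] := gP i.
  have edgeQ (s t : 'I_v) : Q s || Q t -> exists2 r, Q r & uses (edge_mon s t) r.
    by case/orP => Qr; [exists s | exists t];
      rewrite // /uses !mnmDE !mnm1E eqxx ?addn1 ?orbT.
  rewrite -/(minor p q) minorE; apply: mon_idealD; last apply: mon_idealN.
    by apply/mon_idealX/edgeQ/QP.
  by apply/mon_idealX/edgeQ; rewrite orbC; apply: QP.
split.
- apply: contrapT => none.
  have := fibre_sum_J (mdeg a).+1 a fJ.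
  rewrite [f]mpolyE fibre_sum_linear (bigD1_seq a) ?msupp_uniq //=.
  rewrite fibre_sumX ltnSn eqxx mulr1 big1_seq ?addr0 => [/eqP|b /andP [ba bf]].
    by rewrite mcoeff_eq0 af.
  rewrite fibre_sumX; case: eqP => [E|_]; last by rewrite andbF mulr0.
  by case: none; apply: fibre_min E (amax _ bf _); apply/eqP.
- apply: (vars (fun i : 'I_v => (i < m)%N)) af => i j.
  by case: (i < m)%N; case: (j < m)%N.
- apply: (vars (fun i : 'I_v => (m <= i)%N)) af => i j; rewrite ![(m <= _)%N]leqNgt.
  by case: (i < m)%N; case: (j < m)%N.
Qed.

Theorem in_J_KmnE (f : S) : f \in in_J_Kmn K m n <-> mon_ideal in_pred f.
Proof.
split=> [/asboolP [l [c [g [gP ->]]]]|hf].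
  apply: mon_ideal_sum => i _; apply: mon_idealM in_pred_up _.
  by have [h [a [hJ ha ->]]] := gP i; apply/mon_idealX; apply: lead_in_pred ha.
rewrite [f]mpolyE big_seq; apply: (@rpred_sum _ (in_J_Kmn K m n)) => u uf.
rewrite -mul_mpolyC; apply: (@rpredZ _ _ (in_J_Kmn K m n) (f@_u)%:MP).
have [h hJ hu] := in_pred_lead (hf u uf).
apply/asboolP; exists 1%N, (fun=> 1), (fun=> 'X_[u]); split; last by rewrite big_ord1 mul1r.
by move=> _; exists h, u.
Qed.

End InitialIdeal.
(** * Modules presented by a homogeneous ideal *)

Section IdealModules.
Variables (K : fieldType) (N : nat).
Local Notation S := {mpoly K[N]}.
Variables (I : submodClosed S^o) (P : 'X_{1..N} -> Prop).
Hypothesis IP : forall f : S, f \in I <-> mon_ideal P f.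

Lemma quotmod_pi_linear : linear (quotmod_pi I).
Proof. by move=> c f g; rewrite quotmod_piD quotmod_piZ. Qed.

HB.instance Definition _ :=
  GRing.isLinear.Build S S^o (quotmod I) _ (quotmod_pi I) quotmod_pi_linear.

Lemma mon_ideal_hcomp d (f : S) : f \in I -> hcomp d f \in I.
Proof. by move=> /IP fI; apply/IP => u /hcomp_msupp /fI. Qed.

Lemma quot_components : has_components (quot_grading I).
Proof.
move=> l y e w d ye [h hd hE].
have /choice [f fP] i : exists f : S, homog_deg (e i) f /\ quotmod_pi I f = y i.
  by case: (ye i) => f; exists f.
have sumE (c : 'I_l -> S) : \sum_i c i *: y i = quotmod_pi I (\sum_i c i * f i).
  rewrite (linear_sum (quotmod_pi I)); apply: eq_bigr => i _.
  by rewrite -(fP i).2; apply: esym; apply: (quotmod_piZ I (c i) (f i : S^o)).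
apply: etrans (sumE w) (etrans _ (esym (sumE _))).
have {sumE hE} := etrans hE (sumE w).
have BE : hcomp d (\sum_i w i * f i) = \sum_i hcomp (d - e i) (w i) * f i.
  by rewrite linear_sum; apply: eq_bigr => i _; apply: hcompMr (fP i).1.
rewrite -{}BE; move: (\sum_i w i * f i) => A /eqP.
rewrite quotmod_pi_eq => hI; apply/eqP.
have /eqP <- : quotmod_pi I h == quotmod_pi I A by rewrite quotmod_pi_eq.
by rewrite quotmod_pi_eq; have := mon_ideal_hcomp d hI; rewrite linearB /= (hcomp_id hd).
Qed.

Lemma ideal_components : has_components (ideal_grading I).
Proof.
move=> l y e w d ye yd; apply: val_inj.
have sumE (c : 'I_l -> S) : val (\sum_i c i *: y i) = \sum_i c i * (val (y i) : S).
  by apply: (big_ind2 (fun (x : submod I) (f : S) => val x = f)) => // x f x' f' <- <-.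
move: yd; rewrite /ideal_grading !sumE => yd; rewrite -[LHS](hcomp_id yd).
by rewrite linear_sum; apply: eq_bigr => i _; apply: hcompMr (ye i).
Qed.

Variables (G : free_complex K N) (a : 'cV[S]_(frank G 0)).
Hypothesis resG : minimal_ideal_resolution P a.

Definition quot_aug (v : 'rV[S]_1) : quotmod I := quotmod_pi I (v 0 0).

Fact quot_aug_linear : linear quot_aug.
Proof. by move=> c u v; rewrite /quot_aug !mxE linearP. Qed.

HB.instance Definition _ :=
  GRing.isLinear.Build S 'rV[S]_1 (quotmod I) _ quot_aug quot_aug_linear.

Lemma quot_aug_surj : surj quot_aug.
Proof.
move=> q; exists (const_mx (repr (q : Quotient.quot (submod_pred I)))).
by rewrite /quot_aug mxE quotmod_piK.
Qed.

Lemma quot_aug_ker v : quot_aug v = 0 <-> exists w, v = w *m fdiff (splice a) 0.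
Proof.
have [_ _ _ imG] := resG; apply: iff_trans (imG v); apply: iff_trans (IP _).
rewrite /quot_aug -(linear0 (quotmod_pi I)).
by split=> [/eqP|vI]; [rewrite quotmod_pi_eq subr0 | apply/eqP; rewrite quotmod_pi_eq subr0].
Qed.

Fact ideal_aug_in (v : 'rV[S]_(frank G 0)) : (v *m a) 0 0 \in I.
Proof. by have [_ _ _ imG] := resG; apply/IP/imG; exists v. Qed.

Definition ideal_aug (v : 'rV[S]_(frank G 0)) : submod I := SubMod (ideal_aug_in v).

Fact ideal_aug_linear : linear ideal_aug.
Proof. by move=> c u v; apply: val_inj; rewrite /= mulmxDl -scalemxAl !mxE. Qed.

HB.instance Definition _ :=
  GRing.isLinear.Build S 'rV[S]_(frank G 0) (submod I) _ ideal_aug ideal_aug_linear.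

Lemma ideal_aug_surj : surj ideal_aug.
Proof.
move=> x; have [_ _ _ imG] := resG.
have [|w wE] := (imG (const_mx (val x))).1 _; first by rewrite mxE; apply/IP/valP.
by exists w; apply: val_inj; rewrite /= -wE mxE.
Qed.

Lemma ideal_aug_ker v : ideal_aug v = 0 <-> exists w, v = w *m fdiff G 0.
Proof.
have [_ aG _ _] := resG; apply: iff_trans (aG 0%N v) => /=.
split=> [/(congr1 val) /= v0|v0]; last by apply: val_inj; rewrite /= v0 mxE.
by apply/matrixP => i j; rewrite !ord1 v0 mxE.
Qed.

Lemma acyclic_tail : acyclic G.
Proof. by have [_ aG _ _] := resG => i; apply: (aG i.+1). Qed.

Lemma minimal_tail : minimal_complex G.
Proof. by have [_ _ mG _] := resG => i; apply: (mG i.+1). Qed.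

Lemma quot_graded_resolution : graded_free_resolution (quot_grading I) (splice a).
Proof.
have [hG aG _ _] := resG; exists quot_aug; split=> //.
- by move=> k; exists 1; [exact: dhomog1 | rewrite /= /quot_aug mxE !ord1 eqxx].
- exact: quot_aug_surj.
- exact: quot_aug_ker.
Qed.

Lemma ideal_graded_resolution : graded_free_resolution (ideal_grading I) G.
Proof.
have [hG aG _ _] := resG; exists ideal_aug; split.
- move=> k; rewrite /ideal_grading /= -rowE mxE.
  by have := hG 0%N k 0; rewrite /= subr0.
- by move=> i; apply: (hG i.+1).
- exact: ideal_aug_surj.
- exact: ideal_aug_ker.
- exact: acyclic_tail.
Qed.

Lemma betti_quot i j :
  betti (quot_grading I) i j = quot_count (deg_count G) i j.
Proof.
have [_ _ mG _] := resG.
rewrite (betti_minimal quot_components _ _ quot_graded_resolution mG).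
exact: deg_count_splice.
Qed.

Lemma betti_ideal i j : betti (ideal_grading I) i j = deg_count G i j.
Proof.
by rewrite (betti_minimal ideal_components _ _ ideal_graded_resolution minimal_tail).
Qed.

Lemma projdim_ideal n : (0 < frank G n)%N ->
  (forall i, (n < i)%N -> frank G i = 0%N) -> projdim (submod I) = n.
Proof.
exact: projdim_minimal ideal_aug_surj ideal_aug_ker acyclic_tail minimal_tail.
Qed.

Lemma projdim_quot n : (0 < frank G n)%N ->
  (forall i, (n < i)%N -> frank G i = 0%N) -> projdim (quotmod I) = n.+1.
Proof.
have [_ aG mG _] := resG => Gn Ggt.
apply: (@projdim_minimal _ _ _ (splice a) quot_aug n.+1) => //.
- exact: quot_aug_surj.
- exact: quot_aug_ker.
- by case.
Qed.

End IdealModules.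
(** * Linear quotients for the complete bipartite graph *)

Section BipartiteGenerators.
Variables (m n : nat).
Local Notation v := (m + n)%N.

Definition var_a (i : 'I_m) : 'I_(v + v) := lshift v (lshift n i).
Definition var_c (k : 'I_n) : 'I_(v + v) := lshift v (rshift m k).
Definition var_b (i : 'I_m) : 'I_(v + v) := rshift v (lshift n i).
Definition var_d (k : 'I_n) : 'I_(v + v) := rshift v (rshift m k).

Definition var_set (pa : pred 'I_m) (pb : pred 'I_m) (pc : pred 'I_n) (pd : pred 'I_n) :
    {set 'I_(v + v)} :=
  [set x | match split x with
           | inl y => match split y with inl i => pa i | inr k => pc k end
           | inr y => match split y with inl i => pb i | inr k => pd k end
           end].

Lemma var_ind (Q : 'I_(v + v) -> Prop) :
  (forall i, Q (var_a i)) -> (forall i, Q (var_b i)) ->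
  (forall k, Q (var_c k)) -> (forall k, Q (var_d k)) -> forall x, Q x.
Proof.
move=> Qa Qb Qc Qd x.
case: (split_ordP x) => y ->; case: (split_ordP y) => z ->;
  [exact: Qa | exact: Qc | exact: Qb | exact: Qd].
Qed.

Lemma in_var_set pa pb pc pd :
  ((forall i, (var_a i \in var_set pa pb pc pd) = pa i)
  * (forall i, (var_b i \in var_set pa pb pc pd) = pb i)
  * (forall k, (var_c k \in var_set pa pb pc pd) = pc k)
  * (forall k, (var_d k \in var_set pa pb pc pd) = pd k))%type.
Proof.
have sl p q (i : 'I_p) : split (lshift q i) = inl i by exact: (unsplitK (inl i)).
have sr p q (i : 'I_q) : split (rshift p i) = inr i by exact: (unsplitK (inr i)).
by split; [split; [split|]|] => i; rewrite inE /var_a /var_b /var_c /var_d ?sl ?sr ?sl ?sr.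
Qed.

Lemma card_var_set pa pb pc pd :
  #|var_set pa pb pc pd| = (#|pa| + #|pc| + (#|pb| + #|pd|))%N.
Proof.
rewrite -!sum1_card big_split_ord !big_split_ord /=.
have inE4 := in_var_set pa pb pc pd.
congr (_ + _ + (_ + _))%N; apply: eq_bigl => i;
  [exact: inE4.1.1.1 | exact: inE4.1.2 | exact: inE4.1.1.2 | exact: inE4.2].
Qed.

Lemma card_ord_itv p x y : (y <= p)%N ->
  #|[pred i : 'I_p | (x <= i < y)%N]| = (y - x)%N.
Proof.
move=> yp; rewrite -sum1_card -(big_mkord (fun i => x <= i < y)%N (fun=> 1%N)).
have [xy|yx] := leqP x y; last first.
  rewrite big_pred0 => [|i]; last by apply/negbTE; lia.
  by apply/esym/eqP; rewrite subn_eq0 ltnW.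
rewrite -[RHS]muln1 -sum_nat_const_nat [RHS](big_nat_widen _ _ p) // [RHS](big_nat_widenl _ 0%N) //.
by apply: eq_bigl => i /=; rewrite andbC.
Qed.

Lemma card_ord_lt p y : (y <= p)%N -> #|[pred i : 'I_p | (i < y)%N]| = y.
Proof. by move=> yp; rewrite -[RHS]subn0 -(card_ord_itv 0 yp). Qed.

(** The index [inl (i, k)] stands for [a_i d_k], [inr (inl (i, j, k))] for
    [a_i b_j c_k] and [inr (inr (i, k, l))] for [b_i c_k d_l]. *)
Definition gen : Type :=
  ('I_m * 'I_n + ('I_m * 'I_m * 'I_n + 'I_m * 'I_n * 'I_n))%type.
HB.instance Definition _ := Finite.on gen.

Definition is_gen (t : gen) : bool :=
  match t with
  | inl _ => true
  | inr (inl (i, j, _)) => (i < j)%N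
  | inr (inr (_, k, l)) => (k < l)%N
  end.

Definition gen_supp (t : gen) : {set 'I_(v + v)} :=
  match t with
  | inl (i, k) => var_set (pred1 i) pred0 pred0 (pred1 k)
  | inr (inl (i, j, k)) => var_set (pred1 i) (pred1 j) (pred1 k) pred0
  | inr (inr (i, k, l)) => var_set pred0 (pred1 i) (pred1 k) (pred1 l)
  end.

(** Lowering an index of a generator gives an earlier one, except that [j] must
    stay above [i] and [l] above [k].  Moreover any [d] (resp. any [a]) times a
    generator of the second (resp. third) family is a multiple of some [a_i d_k]. *)
Definition colon_vars (t : gen) : {set 'I_(v + v)} :=
  match t with
  | inl (i, k) =>
      var_set [pred i' : 'I_m | (i' < i)%N] pred0 pred0 [pred k' : 'I_n | (k' < k)%N]
  | inr (inl (i, j, k)) =>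
      var_set [pred i' : 'I_m | (i' < i)%N] [pred j' : 'I_m | (i.+1 <= j' < j)%N]
        [pred k' : 'I_n | (k' < k)%N] predT
  | inr (inr (i, k, l)) =>
      var_set predT [pred i' : 'I_m | (i' < i)%N]
        [pred k' : 'I_n | (k' < k)%N] [pred l' : 'I_n | (k.+1 <= l' < l)%N]
  end.

(** Numbers whose digits in base [m + n] are compared lexicographically; the
    leading digit is the family. *)
Definition code (c p q r : nat) : nat := (((c * v + p) * v + q) * v + r)%N.

Definition gen_rank (t : gen) : nat :=
  match t with
  | inl (i, k) => code 0 0 i k
  | inr (inl (i, j, k)) => code 1 i j k
  | inr (inr (i, k, l)) => code 2 i k l
  end.

Lemma digit_lt a b a' b' : (b < v)%N -> (b' < v)%N ->
  (a * v + b < a' * v + b')%N = (a < a')%N || (a == a') && (b < b')%N.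
Proof.
move=> bv bv'; case: (ltngtP a a') => [lt|gt|->] /=; last by rewrite ltn_add2l.
- by apply/idP; nia.
- by apply/negbTE; nia.
Qed.

Lemma digit_eq a b a' b' : (b < v)%N -> (b' < v)%N ->
  (a * v + b == a' * v + b')%N = (a == a') && (b == b').
Proof.
move=> bv bv'; case: (ltngtP a a') => [lt|gt|->] /=; last by rewrite eqn_add2l.
- by apply/negbTE; nia.
- by apply/negbTE; nia.
Qed.

Lemma code_lt c p q r c' p' q' r' :
  (p < v)%N -> (q < v)%N -> (r < v)%N -> (p' < v)%N -> (q' < v)%N -> (r' < v)%N ->
  (code c p q r < code c' p' q' r')%N =
    [|| (c < c')%N, (c == c') && (p < p')%N, [&& c == c', p == p' & (q < q')%N]
      | [&& c == c', p == p', q == q' & (r < r')%N]].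
Proof.
move=> *; rewrite /code !digit_lt // !digit_eq //.
by case: (c < c')%N => //=; case: (c == c') => //=; case: (p < p')%N => //=;
  case: (p == p').
Qed.

Lemma code_eq c p q r c' p' q' r' :
  (p < v)%N -> (q < v)%N -> (r < v)%N -> (p' < v)%N -> (q' < v)%N -> (r' < v)%N ->
  (code c p q r == code c' p' q' r') = [&& c == c', p == p', q == q' & r == r'].
Proof. by move=> *; rewrite /code !digit_eq // -!andbA. Qed.

Lemma ord_lt_l (i : 'I_m) : (i < v)%N. Proof. by have := ltn_ord i; lia. Qed.
Lemma ord_lt_r (k : 'I_n) : (k < v)%N. Proof. by have := ltn_ord k; lia. Qed.
Lemma vertices_gt0 (i : 'I_m) : (0 < v)%N. Proof. by have := ltn_ord i; lia. Qed.

Lemma gen_rank_inj : injective gen_rank.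
Proof.
move=> [[i k]|[[[i j] k]|[[i k] l]]] [[i' k']|[[[i' j'] k']|[[i' k'] l']]] /eqP;
  rewrite /gen_rank code_eq ?ord_lt_l ?ord_lt_r ?(vertices_gt0 i) ?(vertices_gt0 i') //=.
- by move=> /andP [/eqP /val_inj -> /eqP /val_inj ->].
- by move=> /and3P [/eqP /val_inj -> /eqP /val_inj -> /eqP /val_inj ->].
- by move=> /and3P [/eqP /val_inj -> /eqP /val_inj -> /eqP /val_inj ->].
Qed.

Lemma gen_rank_lt (s t : gen) : (gen_rank s < gen_rank t)%N =
  match s, t with
  | inl (i, k), inl (i', k') => (i < i')%N || (i == i') && (k < k')%N
  | inl _, inr _ => true
  | inr _, inl _ => false
  | inr (inl (i, j, k)), inr (inl (i', j', k')) =>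
      [|| (i < i')%N, (i == i') && (j < j')%N | [&& i == i', j == j' & (k < k')%N]]
  | inr (inl _), inr (inr _) => true
  | inr (inr _), inr (inl _) => false
  | inr (inr (i, k, l)), inr (inr (i', k', l')) =>
      [|| (i < i')%N, (i == i') && (k < k')%N | [&& i == i', k == k' & (l < l')%N]]
  end.
Proof.
by case: s => [[i k]|[[[i j] k]|[[i k] l]]]; case: t => [[i' k']|[[[i' j'] k']|[[i' k'] l']]];
  rewrite /gen_rank code_lt ?ord_lt_l ?ord_lt_r ?(vertices_gt0 i) ?(vertices_gt0 i').
Qed.

Lemma card_gen_supp t :
  #|gen_supp t| = if t is inl _ then 2%N else 3%N.
Proof. by case: t => [[i k]|[[[i j] k]|[[i k] l]]]; rewrite card_var_set ?card0 !card1. Qed.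

Lemma card_colon_vars t : is_gen t -> #|colon_vars t| =
  match t with
  | inl (i, k) => (i + k)%N
  | inr (inl (i, j, k)) => (n + j.-1 + k)%N
  | inr (inr (i, k, l)) => (m + i + l.-1)%N
  end.
Proof.
case: t => [[i k]|[[[i j] k]|[[i k] l]]] /=; rewrite card_var_set ?card0 ?card_ord => lt.
- by rewrite !card_ord_lt ?(ltnW (ltn_ord _)) // addn0.
- rewrite !card_ord_lt ?(ltnW (ltn_ord _)) // card_ord_itv ?(ltnW (ltn_ord _)) //; lia.
- rewrite !card_ord_lt ?(ltnW (ltn_ord _)) // card_ord_itv ?(ltnW (ltn_ord _)) //; lia.
Qed.

Lemma colon_fwd s t : is_gen s -> is_gen t -> (gen_rank s < gen_rank t)%N ->
  exists x, [/\ x \in gen_supp s, x \in colon_vars t & x \notin gen_supp t].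
Proof.
have irr p (x y : 'I_p) : (x < y)%N -> x != y by rewrite -val_eqE ltn_neqAle => /andP [].
rewrite gen_rank_lt.
case: s => [[i k]|[[[i j] k]|[[i k] l]]]; case: t => [[i' k']|[[[i' j'] k']|[[i' k'] l']]] //= gs gt.
- case/orP => [lt|/andP [/eqP -> lt]].
    by exists (var_a i); rewrite !in_var_set /= eqxx lt irr.
  by exists (var_d k); rewrite !in_var_set /= eqxx lt irr.
- by exists (var_d k); rewrite !in_var_set /= eqxx.
- by exists (var_a i); rewrite !in_var_set /= eqxx.
- case/or3P => [lt|/andP [/eqP E lt]|/and3P [_ _ lt]].
  + by exists (var_a i); rewrite !in_var_set /= eqxx lt irr.
  + by exists (var_b j); rewrite !in_var_set /= eqxx lt irr // -E gs.
  + by exists (var_c k); rewrite !in_var_set /= eqxx lt irr.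
- by exists (var_a i); rewrite !in_var_set /= eqxx.
- case/or3P => [lt|/andP [_ lt]|/and3P [_ /eqP E lt]].
  + by exists (var_b i); rewrite !in_var_set /= eqxx lt irr.
  + by exists (var_c k); rewrite !in_var_set /= eqxx lt irr.
  + by exists (var_d l); rewrite !in_var_set /= eqxx lt irr // -E gs.
Qed.

Lemma var_set_sub (pa pb : pred 'I_m) (pc pd : pred 'I_n) (B : {set 'I_(v + v)}) :
  (forall i, pa i -> var_a i \in B) -> (forall i, pb i -> var_b i \in B) ->
  (forall k, pc k -> var_c k \in B) -> (forall k, pd k -> var_d k \in B) ->
  var_set pa pb pc pd \subset B.
Proof.
by move=> ha hb hc hd; apply/subsetP; apply: var_ind => z; rewrite in_var_set;
  [apply: ha | apply: hb | apply: hc | apply: hd].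
Qed.

Lemma colon_bwd t x : is_gen t -> x \in colon_vars t ->
  exists s, [/\ is_gen s, (gen_rank s < gen_rank t)%N & gen_supp s \subset x |: gen_supp t].
Proof.
have sub s y u : gen_supp s \subset y |: gen_supp u <->
  match s with
  | inl (i, k) => var_a i \in y |: gen_supp u /\ var_d k \in y |: gen_supp u
  | inr (inl (i, j, k)) => [/\ var_a i \in y |: gen_supp u, var_b j \in y |: gen_supp u
      & var_c k \in y |: gen_supp u]
  | inr (inr (i, k, l)) => [/\ var_b i \in y |: gen_supp u, var_c k \in y |: gen_supp u
      & var_d l \in y |: gen_supp u]
  end.
  split=> [/subsetP h|].
    by case: s h => [[i k]|[[[i j] k]|[[i k] l]]] h; split; apply: h; rewrite in_var_set /=.
  by case: s => [[i k]|[[[i j] k]|[[i k] l]]] [] *; apply: var_set_sub => // z /eqP ->.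
case: t => [[i k]|[[[i j] k]|[[i k] l]]]; move: x; apply: var_ind => z gt;
  rewrite in_var_set // => lt; rewrite /= in lt.
- exists (inl (z, k)); split; first by [].
    by rewrite gen_rank_lt /= lt.
  by apply/sub; rewrite /= !in_setU1 !in_var_set /= !eqxx ?orbT.
- exists (inl (i, z)); split; first by [].
    by rewrite gen_rank_lt /= lt eqxx orbT.
  by apply/sub; rewrite /= !in_setU1 !in_var_set /= !eqxx ?orbT.
- exists (inr (inl (z, j, k))); split; first exact: ltn_trans lt gt.
    by rewrite gen_rank_lt /= lt.
  by apply/sub; rewrite /= !in_setU1 !in_var_set /= !eqxx ?orbT.
- case/andP: lt => iz zj; exists (inr (inl (i, z, k))); split; first by [].
    by rewrite gen_rank_lt /= zj eqxx orbT.
  by apply/sub; rewrite /= !in_setU1 !in_var_set /= !eqxx ?orbT.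
- exists (inr (inl (i, j, z))); split; first by [].
    by rewrite gen_rank_lt /= lt !eqxx !orbT.
  by apply/sub; rewrite /= !in_setU1 !in_var_set /= !eqxx ?orbT.
- exists (inl (i, z)); split; first by [].
    by rewrite gen_rank_lt .
  by apply/sub; rewrite /= !in_setU1 !in_var_set /= !eqxx ?orbT.
- exists (inl (z, l)); split; first by [].
    by rewrite gen_rank_lt .
  by apply/sub; rewrite /= !in_setU1 !in_var_set /= !eqxx ?orbT.
- exists (inr (inr (z, k, l))); split; first by [].
    by rewrite gen_rank_lt /= lt.
  by apply/sub; rewrite /= !in_setU1 !in_var_set /= !eqxx ?orbT.
- exists (inr (inr (i, z, l))); split; first exact: ltn_trans lt gt.
    by rewrite gen_rank_lt /= lt eqxx orbT.
  by apply/sub; rewrite /= !in_setU1 !in_var_set /= !eqxx ?orbT.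
- case/andP: lt => kz zl; exists (inr (inr (i, k, z))); split; first by [].
    by rewrite gen_rank_lt /= zl !eqxx !orbT.
  by apply/sub; rewrite /= !in_setU1 !in_var_set /= !eqxx ?orbT.
Qed.

Definition gen_count i (j : int) : nat :=
  (\sum_(t : gen | is_gen t) 'C(#|colon_vars t|, i) * (j == (i + #|gen_supp t|)%N))%N.

Lemma gen_supp_le (u : 'X_{1..v + v}) (t : gen) :
  (forall x, x \in gen_supp t -> (0 < u x)%N) <->
  match t with
  | inl (i, k) => (0 < u (var_a i))%N /\ (0 < u (var_d k))%N
  | inr (inl (i, j, k)) =>
      [/\ (0 < u (var_a i))%N, (0 < u (var_b j))%N & (0 < u (var_c k))%N]
  | inr (inr (i, k, l)) =>
      [/\ (0 < u (var_b i))%N, (0 < u (var_c k))%N & (0 < u (var_d l))%N]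
  end.
Proof.
split=> [h|].
  by case: t h => [[i k]|[[[i j] k]|[[i k] l]]] h; split; apply: h; rewrite in_var_set /=.
case: t => [[i k]|[[[i j] k]|[[i k] l]]] [].
- by move=> ua ud; apply: var_ind => z; rewrite in_var_set // => /eqP ->.
- by move=> ua ub uc; apply: var_ind => z; rewrite in_var_set // => /eqP ->.
- by move=> ub uc ud; apply: var_ind => z; rewrite in_var_set // => /eqP ->.
Qed.

(** The two vertices of [x_i y_j] may lie on different sides, which gives
    [a_i d_k], or on the same side, and then a variable of the other side
    completes them to a cubic generator or to a multiple of some [a_i d_k]. *)
Lemma in_pred_gen (u : 'X_{1..v + v}) : @in_pred m n u <->
  exists2 t, is_gen t & forall x, x \in gen_supp t -> (0 < u x)%N.
Proof.
split.
  case=> [[i [j [ij xi yj]]] [p pm up] [q mq uq]].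
  case: (split_ordP p) up pm => p' -> up pm; last by move: pm => /=; lia.
  case: (split_ordP q) uq mq => q' -> uq mq; first by move: mq => /=; have := ltn_ord q'; lia.
  case: (split_ordP i) ij xi yj => i' ->; case: (split_ordP j) => j' -> /= ij xi yj.
  - case/orP: uq => uq; first by exists (inr (inl (i', j', q'))) => //; apply/gen_supp_le.
    by exists (inl (i', q')) => //; apply/gen_supp_le.
  - by exists (inl (i', j')) => //; apply/gen_supp_le.
  - by have := ltn_ord j'; lia.
  - rewrite ltn_add2l in ij; case/orP: up => up.
      by exists (inl (p', j')) => //; apply/gen_supp_le.
    by exists (inr (inr (p', i', j'))) => //; apply/gen_supp_le.
case=> t tg /gen_supp_le.
case: t tg => [[i k]|[[[i j] k]|[[i k] l]]] /= tg [].
- move=> ua ud; split.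
  + by exists (lshift n i), (rshift m k); split=> //=; have := ltn_ord i; lia.
  + by exists (lshift n i); rewrite /= ?ltn_ord // /uses ua.
  + by exists (rshift m k); rewrite /= ?leq_addr // /uses ud orbT.
- move=> ua ub uc; split.
  + by exists (lshift n i), (lshift n j).
  + by exists (lshift n i); rewrite /= ?ltn_ord // /uses ua.
  + by exists (rshift m k); rewrite /= ?leq_addr // /uses uc.
- move=> ub uc ud; split.
  + by exists (rshift m k), (rshift m l); split; rewrite //= ltn_add2l.
  + by exists (lshift n i); rewrite /= ?ltn_ord // /uses ub orbT.
  + by exists (rshift m k); rewrite /= ?leq_addr // /uses uc.
Qed.

Lemma in_J_resolution (K : fieldType) : has_resolution K (@in_pred m n) gen_count.
Proof.
apply: has_resolution_ext (squarefree_linear_quotients K (A := is_gen) (supp := gen_supp)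
  (V := colon_vars) (rk := gen_rank) _ _ _ _ _).
- by move=> u; apply: iff_sym; apply: in_pred_gen.
- by [].
- by move=> s t _ _; apply: gen_rank_inj.
- by move=> t _; rewrite card_gen_supp; case: t.
- move=> s t _ _; rewrite gen_rank_lt !card_gen_supp.
  by case: s => [[i k]|[[[i j] k]|[[i k] l]]]; case: t => [[i' k']|[[[i' j'] k']|[[i' k'] l']]].
- exact: colon_fwd.
- exact: colon_bwd.
Qed.

End BipartiteGenerators.
(** * The top of the resolution *)

Section TopBetti.
Variables (m n : nat).
Hypotheses (hn : (1 <= n)%N) (hmn : (n <= m)%N).

(** The largest number of colon variables of a generator. *)
Definition ideal_pd : nat := if n == 1 then (m - 1)%N else (2 * m + n - 3)%N.

Lemma colon_vars_le (t : gen m n) : is_gen t -> (#|colon_vars t| <= ideal_pd)%N.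
Proof.
move=> tg; rewrite card_colon_vars // /ideal_pd; move: tg.
case: t => [[i k]|[[[i j] k]|[[i k] l]]] /= lt.
- by have := ltn_ord i; have := ltn_ord k; case: eqP; lia.
- by have := ltn_ord j; have := ltn_ord k; case: eqP; lia.
- by have := ltn_ord i; have := ltn_ord l; case: eqP; lia.
Qed.

Lemma colon_vars_top : exists2 t : gen m n, is_gen t & #|colon_vars t| = ideal_pd.
Proof.
have m1 : (m - 1 < m)%N by lia.
have n0 : (0 < n)%N by lia.
have n1 : (n - 1 < n)%N by lia.
rewrite /ideal_pd; case: eqP => nE.
  by exists (inl (Ordinal m1, Ordinal n0)) => //; rewrite card_colon_vars //= addn0.
exists (inr (inr (Ordinal m1, Ordinal n0, Ordinal n1))); first by rewrite /=; lia.
by rewrite card_colon_vars /=; lia.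
Qed.

Lemma gen_count_neq0 i j : @gen_count m n i j != 0%N ->
  exists t : gen m n, [/\ is_gen t, (i <= #|colon_vars t|)%N & j = (i + #|gen_supp t|)%N].
Proof.
rewrite /gen_count sum_nat_eq0 => /forall_inPn [t tg].
rewrite muln_eq0 negb_or eqb0 negbK -lt0n bin_gt0 => /andP [it /eqP ->].
by exists t.
Qed.

Lemma gen_count_gt0 (t : gen m n) : is_gen t ->
  gen_count m n #|colon_vars t| (#|colon_vars t| + #|gen_supp t|)%N != 0%N.
Proof.
move=> tg; rewrite /gen_count (bigD1 t) //= binn eqxx //.
Qed.

Lemma sum_ord_last p (c : bool) : (0 < p)%N ->
  (\sum_(k < p) (c && (k == (p - 1)%N :> nat)) = c)%N.
Proof.
move=> p0; have lp : (p - 1 < p)%N by lia.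
rewrite (bigD1 (Ordinal lp)) //= eqxx andbT big1 ?addn0 // => k.
by rewrite -val_eqE /= => /negPf ->; rewrite andbF.
Qed.

Lemma sum_ord_lt p (c : bool) : (0 < p)%N ->
  (\sum_(k < p) (c && (k < p - 1)%N) = c * (p - 1))%N.
Proof.
move=> p0; rewrite -[in RHS](card_ord_lt (leq_subr 1 p)) -sum1_card big_distrr /=.
rewrite [RHS]big_mkcond /=; apply: eq_bigr => k _; rewrite inE.
by case: c; case: (k < p - 1)%N.
Qed.

(** In homological degree [ideal_pd] the generators of degree 3 with fewer colon
    variables contribute nothing and those with [ideal_pd] of them contribute 1:
    these are the [a_i b_m c_n] when [n = 1] or [m = n], and the [b_m c_k d_n]. *)
Lemma gen_count_top : gen_count m n ideal_pd (ideal_pd + 3)%N =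
  if n == 1 then (m - 1)%N else if m == n then (2 * (n - 1))%N else (n - 1)%N.
Proof.
have m0 : (0 < m)%N by lia.
have termE (t : gen m n) : is_gen t ->
    ('C(#|colon_vars t|, ideal_pd)
       * ((ideal_pd + 3)%N == (ideal_pd + #|gen_supp t|)%N :> int) = (#|gen_supp t| == 3) && (#|colon_vars t| == ideal_pd))%N.
  move=> tg; rewrite eqz_nat eqn_add2l [3 == _]eq_sym.
  case: (#|gen_supp t| == 3); rewrite ?muln0 // muln1 /=.
  have := colon_vars_le tg; rewrite leq_eqVlt => /orP [/eqP ->|lt].
    by rewrite binn eqxx.
  by rewrite bin_small // ltn_eqF.
pose flag := (n == 1) || (m == n).
have E2 : (\sum_(t : 'I_m * 'I_m * 'I_n | is_gen (inr (inl t) : gen m n))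
    ((#|gen_supp (inr (inl t) : gen m n)| == 3)
      && (#|colon_vars (inr (inl t) : gen m n)| == ideal_pd)) = flag * (m - 1))%N.
  pose f (i j : 'I_m) (k : 'I_n) : nat :=
    flag && (i < m - 1)%N && (j == (m - 1)%N :> nat) && (k == (n - 1)%N :> nat).
  transitivity (\sum_i \sum_j \sum_k f i j k)%N; last first.
    rewrite -(sum_ord_lt flag m0); apply: eq_bigr => i _; rewrite -(sum_ord_last _ m0).
    by apply: eq_bigr => j _; rewrite /f sum_ord_last.
  rewrite pair_bigA pair_bigA big_mkcond; apply: eq_bigr => -[[i j] k] _ /=.
  rewrite /f /=; case: ifP => [ij|/negbT ij].
    rewrite (card_gen_supp (inr (inl (i, j, k)))) (card_colon_vars (t := inr (inl (i, j, k)))) //.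
    congr nat_of_bool; rewrite /flag /ideal_pd.
    by have := ltn_ord j; have := ltn_ord k; case: (n =P 1%N) => nE; lia.
  by have := ltn_ord i; have := ltn_ord j; lia.
have E3 : (\sum_(t : 'I_m * 'I_n * 'I_n | is_gen (inr (inr t) : gen m n))
    ((#|gen_supp (inr (inr t) : gen m n)| == 3)
      && (#|colon_vars (inr (inr t) : gen m n)| == ideal_pd)) = n - 1)%N.
  pose f (i : 'I_m) (k l : 'I_n) : nat :=
    (k < n - 1)%N && (i == (m - 1)%N :> nat) && (l == (n - 1)%N :> nat).
  transitivity (\sum_i \sum_k \sum_l f i k l)%N; last first.
    rewrite exchange_big -[RHS]mul1n -(sum_ord_lt true hn); apply: eq_bigr => k _.
    rewrite -(sum_ord_last _ m0).
    by apply: eq_bigr => i _; rewrite /f sum_ord_last.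
  rewrite pair_bigA pair_bigA big_mkcond; apply: eq_bigr => -[[i k] l] _ /=.
  rewrite /f /=; case: ifP => [kl|/negbT kl].
    rewrite (card_gen_supp (inr (inr (i, k, l)))) (card_colon_vars (t := inr (inr (i, k, l)))) //.
    congr nat_of_bool; rewrite /ideal_pd.
    by have := ltn_ord i; have := ltn_ord l; case: (n =P 1%N) => nE; lia.
  by have := ltn_ord k; have := ltn_ord l; lia.
rewrite /gen_count (eq_bigr _ termE) big_sumType.
have q0 : (\sum_(t : 'I_m * 'I_n | is_gen (inl t : gen m n))
    ((#|gen_supp (inl t : gen m n)| == 3)
      && (#|colon_vars (inl t : gen m n)| == ideal_pd)) = 0)%N.
  by rewrite big1 // => t _; rewrite (card_gen_supp (inl t)).
transitivity (0 + (flag * (m - 1) + (n - 1)))%N.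
  congr (_ + _)%N; first exact: q0.
  by rewrite big_sumType; congr (_ + _)%N; [exact: E2 | exact: E3].
rewrite /flag; case: (n =P 1%N) => [->|nE]; first by lia.
by case: (m =P n) => [->|mE] /=; lia.
Qed.

End TopBetti.

Theorem corollary2p3 (K : fieldType) (m n : nat)
    (hn : (1 <= n)%N) (hmn : (n <= m)%N) :
  let I := in_J_Kmn K m n in
  let p := projdim (quotmod I) in
  (p = (projdim (submod I) + 1)%N /\
   p = (if n == 1 then m else 2 * m + n - 2)%N)
  /\
  (betti (quot_grading I) p (p%:Z + 2) =
     betti (ideal_grading I) (p - 1)%N (p%:Z + 2) /\
   betti (quot_grading I) p (p%:Z + 2) =
     (if n == 1 then m - 1
      else if m == n then 2 * (n - 1)
      else n - 1)%N /\
   ((m, n) <> (1%N, 1%N) ->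
    forall (i : nat) (j : int),
      extremal_betti (quot_grading I) i j <-> i = p /\ j = 2)).
Proof.
have IP := @in_J_KmnE K m n.
have [G [a [rG cE]]] := in_J_resolution m n K.
have Gtop : (0 < frank G (ideal_pd m n))%N.
  have [t tg tV] := colon_vars_top hn hmn.
  have := gen_count_gt0 tg; rewrite tV -cE -lt0n => /leq_trans; apply.
  by rewrite -[leqRHS]card_ord; apply: max_card.
have Ggt i : (ideal_pd m n < i)%N -> frank G i = 0%N.
  move=> lt; apply/eqP; rewrite -leqn0 leqNgt; apply/negP => Gi.
  have := deg_count_gt0 (Ordinal Gi); rewrite cE => /gen_count_neq0 [t [tg it _]].
  have := colon_vars_le hn hmn tg; lia.
move=> I p; have pE : p = (ideal_pd m n).+1 by apply: (projdim_quot IP rG).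
have bS i j : betti (quot_grading I) i j = quot_count (gen_count m n) i j.
  by rewrite (betti_quot IP rG); case: i => //= i; rewrite cE.
have topE : betti (quot_grading I) p (p%:Z + 2) =
    if n == 1 then (m - 1)%N else if m == n then (2 * (n - 1))%N else (n - 1)%N.
  rewrite bS pE /= -(gen_count_top hn hmn); congr (gen_count _ _ _ _); lia.
split; first split.
- by rewrite pE (projdim_ideal IP rG Gtop Ggt) addn1.
- by rewrite pE /ideal_pd; case: eqP; lia.
split; last split=> // mn.
  by rewrite bS (betti_ideal IP rG) cE pE subn1.
have top_neq0 : betti (quot_grading I) p (p%:Z + 2) <> 0%N.
  rewrite topE; case: (n =P 1%N) => [n1|n1]; last by case: eqP; lia.
  by move=> m1; apply: mn; congr (_, _); lia.
(* All nonzero Betti numbers lie below the corner [(p, 2)], which is itself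
   nonzero: it is therefore the only extremal position. *)
have support i j : betti (quot_grading I) i (i%:Z + j) != 0%N -> (i <= p)%N /\ j <= 2.
  rewrite bS pE; case: i => [|i] /=.
    by rewrite eqb0 negbK add0r => /eqP ->.
  move=> /gen_count_neq0 [t [tg it jE]]; have := leq_trans it (colon_vars_le hn hmn tg).
  by move: jE; rewrite card_gen_supp; case: (t) => ?; lia.
move=> i j; split=> [[ij_neq0 ext]|[-> ->]].
  have [ip j2] := support i j (introN eqP ij_neq0).
  have [[-> ->] //|/eqP ne] := eqVneq (i, j) (p, 2 : int).
  by case: top_neq0; apply: ext => // E; apply: ne; rewrite E.
split=> // k l ne pk l2; apply/eqP; apply: contra_notT ne => /support [kp lj].
by congr (_, _); [apply/eqP; rewrite eqn_leq kp | apply/eqP; rewrite eq_le lj].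
Qed.
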